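(* There is no strongly regular graph with any of the following parameters $(v,k,\lambda,\mu)$: $$(351,140,73,44),\qquad (550,162,75,36),\qquad (703,182,81,35),\qquad (1344,221,88,26).$$ There is also no strongly regular graph with any of the complementary parameter sets $(v,\,v-k-1,\,v-2k+\mu-2,\,v-2k+\lambda)$, that is, with any of $$(351,210,113,144),\qquad (550,387,260,301),\qquad (703,520,372,420),\qquad (1344,1122,926,990).$$
   Context: A strongly regular graph with parameters $(v,k,\lambda,\mu)$ is a simple $k$-regular graph on $v$ vertices in which any two adjacent vertices have exactly $\lambda$ common neighbors and any two distinct nonadjacent vertices have exactly $\mu$ common neighbors. *)

(* Defs.v *)
From mathcomp Require Import all_boot.

Set Implicit Arguments.
Unset Strict Implicit.
Unset Printing Implicit Defensive.

Definition simple_graph (T : finType) (adj : rel T) : Prop :=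
  symmetric adj /\ irreflexive adj.

Definition neighbors (T : finType) (adj : rel T) (x : T) : {set T} :=
  [set y | adj x y].

Definition regular_graph (T : finType) (adj : rel T) (k : nat) : Prop :=
  forall x : T, #|neighbors adj x| = k.

Definition common_neighbors (T : finType) (adj : rel T) (x y : T) : {set T} :=
  neighbors adj x :&: neighbors adj y.

Record strongly_regular (T : finType) (adj : rel T)
    (v k lambda mu : nat) : Prop := StronglyRegular {
  srg_simple : simple_graph adj;
  srg_order : #|T| = v;
  srg_regular : regular_graph adj k;
  srg_adj : forall x y : T, adj x y -> #|common_neighbors adj x y| = lambda;
  srg_nonadj : forall x y : T,
    x != y -> ~~ adj x y -> #|common_neighbors adj x y| = mu
}.

(* Main.v *)
Require Import Defs.
From mathcomp Require Import all_boot all_order all_algebra.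
From mathcomp Require Import complex realalg ring lra zify.

Set Implicit Arguments.
Unset Strict Implicit.
Unset Printing Implicit Defensive.

(* Complementation leaves four graphs, each with restricted eigenvalues [r] and
   [-3].  Write [u_x] for the projection of the vertex [x] onto the
   [r]-eigenspace, of dimension [f].  For a vertex [a] and an eigenvector [w] of
   the local graph at [a], the distance in the symmetric square of the
   eigenspace from [u_a w] to the span of the squares [u_x ^ 2] is nonnegative.
   This says that a certain quadratic polynomial with two roots is nonnegative
   at every local eigenvalue other than [lambda] and [-3], so these at most
   [f - 1] eigenvalues avoid an open interval, while their sum and their sum of
   squares are known.
   - For (351,140,73,44) and (703,182,81,35) the sums force all of them to be
     roots of the quadratic; its discriminant is not compatible with the trace.
   - For (550,162,75,36) the number of eigenvalues above the gap would lie
     strictly between 2 and 3.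
   - For (1344,221,88,26) at most two of them lie above the gap, hence at most
     three eigenvalues exceed 7, and so the local graph has no four pairwise
     non-adjacent vertices.  This forces it to be the union of three cliques,
     but cliques in it have at most 73 vertices and 3 * 73 < 221. *)

(** * Graphs without four independent vertices *)

Section LocalGraph.
Variables (T : finType) (adj : rel T) (S : {set T}).
Hypotheses (symA : symmetric adj) (irrA : irreflexive adj).

Local Notation N := (neighbors adj).

Definition non_neighbors x : {set T} := [set y | (x != y) && ~~ adj x y].
Local Notation F := non_neighbors.

Definition is_clique (K : {set T}) : bool :=
  [forall x in K, forall y in K, (x != y) ==> adj x y].

Lemma cliqueP (K : {set T}) :
  reflect {in K &, forall x y, x != y -> adj x y} (is_clique K).
Proof.
apply: (iffP forall_inP) => [cK x y xK yK xy|cK x xK].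
  by have /forall_inP/(_ y yK)/implyP/(_ xy) := cK x xK.
by apply/forall_inP => y yK; apply/implyP; apply: cK.
Qed.

Lemma cliquePn (K : {set T}) : ~~ is_clique K ->
  exists x y, [/\ x \in K, y \in K & y \in F x].
Proof.
case/forall_inPn => x xK /forall_inPn[y yK]; rewrite negb_imply => xy.
by exists x, y; rewrite inE.
Qed.

Lemma non_neighborsC x y : (x \in F y) = (y \in F x).
Proof. by rewrite !inE symA eq_sym. Qed.

Lemma card_split (U : {set T}) x :
  #|U| = (x \in U) + #|U :&: N x| + #|U :&: F x|.
Proof.
rewrite (cardsD1 x) -addnA; congr (_ + _).
rewrite -(cardsID (N x) (U :\ x)); congr (_ + _); apply: eq_card => y.
  rewrite !inE; case: eqVneq => [->|]; rewrite ?irrA ?andbF //.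
by rewrite !inE [x == y]eq_sym; case: (y == x); case: (y \in U); case: adj.
Qed.

(** In the application [S] is the neighborhood of a vertex [a] of a (1344,221,88,26) graph. The
    bound 25 is 26 - 1 because [a] is a further common neighbor outside [S], and 73 is 74 - 1
    because [a] can be adjoined to a clique of [S]. *)
Hypothesis cardS : #|S| = 221.
Hypothesis degS : forall x, x \in S -> #|S :&: N x| = 88.
Hypothesis commonS : forall x y, x \in S -> y \in S -> y \in F x ->
  #|S :&: N x :&: N y| <= 25.
Hypothesis cliqueS : forall K : {set T}, K \subset S -> is_clique K -> #|K| <= 73.
Hypothesis indepS : forall x y z w, x \in S -> y \in S -> z \in S -> w \in S ->
  y \in F x -> z \in F x -> w \in F x -> z \in F y -> w \in F y -> w \in F z ->
  False.

Lemma card_non_neighbors x : x \in S -> #|S :&: F x| = 132.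
Proof. by move=> xS; have := card_split S x; rewrite cardS degS // xS; lia. Qed.

(** Of the 132 non-neighbors of [x], one is [y], and those adjacent to [y] are its 88 neighbors less
    the common ones. *)
Lemma card_non_neighbors2 x y : x \in S -> y \in S -> y \in F x ->
  #|S :&: F x :&: F y| = 43 + #|S :&: N x :&: N y|.
Proof.
move=> xS yS xy; have := card_split (S :&: F x) y.
rewrite card_non_neighbors // inE yS xy /=.
have /negPf xNy : x \notin N y by move: xy; rewrite !inE symA => /andP[].
have := card_split (S :&: N y) x; rewrite degS // in_setI xNy andbF.
by rewrite -!setIA [N y :&: N x]setIC [N y :&: F x]setIC; lia.
Qed.

Lemma non_neighbors2_clique x y : x \in S -> y \in S -> y \in F x ->
  is_clique (S :&: F x :&: F y).
Proof.
move=> xS yS xy; apply: contraT => /cliquePn[z [w [+ + zw]]].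
rewrite 2!in_setI => /andP[/andP[zS xz] yz].
rewrite 2!in_setI => /andP[/andP[wS xw] yw].
by case: (indepS xS yS zS wS xy xz xw yz yw zw).
Qed.

(** No vertex of [S] is non-adjacent to all three, so the common non-neighbors of [x] and [y] other
    than [z] are neighbors of [z]. The remaining neighbors of [z] are adjacent to [x] or [y];
    counting all 88 leaves 88 - 42 = 46. *)
Lemma common_sum x y z : x \in S -> y \in S -> z \in S ->
  y \in F x -> z \in F x -> z \in F y ->
  46 <= #|S :&: N x :&: N y| + #|S :&: N x :&: N z| + #|S :&: N y :&: N z|.
Proof.
move=> xS yS zS xy xz yz.
have H1 := card_non_neighbors2 xS yS xy.
have H2 := card_split (S :&: F x :&: F y) z.
have H3 : #|S :&: F x :&: F y :&: F z| = 0.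
  apply: eq_card0 => w; apply/negP; rewrite 3!in_setI.
  case/andP=> /andP[/andP[wS xw] yw zw].
  exact: (indepS xS yS zS wS).
have H4 := card_split (S :&: N z) x; have H5 := card_split (S :&: N z :&: F x) y.
have xz' : x \notin N z.
  by move: xz; rewrite !inE symA => /andP[].
have yz' : y \notin N z.
  by move: yz; rewrite !inE symA => /andP[].
move: H4 H5; rewrite degS // !in_setI (negPf xz') (negPf yz') !andbF /= => H4 H5.
move: H2; rewrite H1 H3 !in_setI zS xz yz /= => H2.
have H6 : #|S :&: N z :&: F x :&: N y| <= #|S :&: N y :&: N z|.
  apply: subset_leq_card; apply/subsetP => w; rewrite !in_setI.
  by case/andP => /andP[/andP[-> ->] _] ->.
have H7 : #|S :&: N z :&: F x :&: F y| = #|S :&: F x :&: F y :&: N z|.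
  by apply: eq_card => w; rewrite !in_setI; do !case: (_ \in _).
have H8 : #|S :&: N z :&: N x| = #|S :&: N x :&: N z|.
  by rewrite -!setIA [N z :&: _]setIC.
lia.
Qed.

(** A neighbor of [u] in [K] is a common neighbor of [u] and [w]. *)
Lemma few_neighbors (K : {set T}) u w : K \subset S -> is_clique K -> w \in K ->
  u \in S -> w \in F u -> #|K :&: N u| <= 25.
Proof.
move=> KS /cliqueP cK wK uS uw; apply: leq_trans (commonS uS (subsetP KS _ wK) uw).
apply: subset_leq_card; apply/subsetP => x; rewrite !in_setI => /andP[xK xu].
rewrite (subsetP KS) // xu inE cK //; apply/eqP => wx.
by move: uw; rewrite wx inE; move: xu; rewrite inE => ->; rewrite andbF.
Qed.

Definition max_clique (K : {set T}) : Prop :=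
  [/\ K \subset S, is_clique K
    & forall u, u \in S -> u \notin K -> exists2 w, w \in K & w \in F u].

Lemma max_clique_exists (K0 : {set T}) : K0 \subset S -> is_clique K0 ->
  exists2 K, max_clique K & K0 \subset K.
Proof.
move=> K0S cK0; pose P (K : {set T}) := (K \subset S) && is_clique K.
have [|K /maxsetP[/andP[KS cK] maxK] K0K] := @maxset_exists _ P K0.
  by rewrite /P K0S.
exists K => //; split=> // u uS uK.
have : ~~ is_clique (u |: K).
  apply: contra uK => cuK; rewrite -(maxK (u |: K)) ?setU11 ?subsetUr //.
  by rewrite /P cuK subUset sub1set uS KS.
case/cliquePn => x [y [+ + xy]]; rewrite !in_setU1.
case/predU1P => [xu|xK] /predU1P[yu|yK].
- by move: xy; rewrite xu yu inE eqxx.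
- by exists y; rewrite // -xu.
- by exists x; rewrite // non_neighborsC -yu.
- by move: xy; rewrite inE => /andP[/(cliqueP _ cK _ _ xK yK) ->].
Qed.

Lemma max_clique_few (K : {set T}) u : max_clique K -> u \in S -> u \notin K ->
  #|K :&: N u| <= 25.
Proof.
case=> KS cK maxK uS uK; have [w wK uw] := maxK u uS uK.
exact: few_neighbors wK uS uw.
Qed.

(** As [u] and [v] each have at most 25 neighbors in [K], some [w] in [K] is adjacent to neither.
    The cliques [K] and [Q] share [w], so their union without [w] lies among its 88 neighbors;
    inclusion-exclusion with [card_non_neighbors2] gives 46 = 89 - 43. *)
Lemma max_clique_non_neighbors2 (K : {set T}) u v : max_clique K -> 50 < #|K| ->
  u \in S -> v \in S -> u \notin K -> v \notin K -> v \in F u ->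
  #|K| + #|S :&: N u :&: N v| <= #|K :&: F u :&: F v| + 46.
Proof.
move=> mK K50 uS vS uK vK uv; have [KS /cliqueP cK _] := mK.
have := card_split K u; have := card_split (K :&: F u) v.
rewrite in_setI (negPf uK) (negPf vK) /= => H1 H2.
have H3 := max_clique_few mK uS uK; have H4 := max_clique_few mK vS vK.
have H5 : #|K :&: F u :&: N v| <= #|K :&: N v|.
  by apply: subset_leq_card; rewrite setSI // subsetIl.
have /card_gt0P[w] : 0 < #|K :&: F u :&: F v| by lia.
rewrite !in_setI => /andP[/andP[wK uw] vw].
pose Q := S :&: F u :&: F v.
have /cliqueP cQ : is_clique Q by exact: non_neighbors2_clique.
have wQ : w \in Q by rewrite !in_setI (subsetP KS) ?uw.
have : #|(K :|: Q) :\ w| <= #|S :&: N w|.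
  apply: subset_leq_card; apply/subsetP => x.
  rewrite in_setD1 in_setU in_setI [x \in N w]inE eq_sym => /andP[wx].
  case/orP => [xK|xQ]; first by rewrite cK // (subsetP KS).
  by rewrite cQ // andbT; move: xQ; rewrite !in_setI => /andP[/andP[]].
rewrite degS ?(subsetP KS) // => H6.
have := cardsD1 w (K :|: Q); rewrite in_setU wK /= => H7.
have := cardsUI K Q; rewrite {3}/Q card_non_neighbors2 //.
have -> : K :&: Q = K :&: F u :&: F v.
  by rewrite /Q !setIA (setIidPl KS).
lia.
Qed.

(* Each [K :&: F u :&: F v] is large while these three sets are disjoint. *)
Lemma no_triple_outside (K : {set T}) u1 u2 u3 : max_clique K -> 50 < #|K| ->
  u1 \in S -> u2 \in S -> u3 \in S ->
  u1 \notin K -> u2 \notin K -> u3 \notin K ->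
  u2 \in F u1 -> u3 \in F u1 -> u3 \in F u2 -> False.
Proof.
move=> mK K50 S1 S2 S3 K1 K2 K3 f12 f13 f23; have [KS _ _] := mK.
have := max_clique_non_neighbors2 mK K50 S1 S2 K1 K2 f12.
have := max_clique_non_neighbors2 mK K50 S1 S3 K1 K3 f13.
have := max_clique_non_neighbors2 mK K50 S2 S3 K2 K3 f23.
have := common_sum S1 S2 S3 f12 f13 f23.
have := card_split K u1; have := card_split (K :&: F u1) u2.
have no4 w : w \in K -> w \in F u1 -> w \in F u2 -> w \in F u3 -> False.
  by move=> /(subsetP KS) wS w1 w2 w3; apply: (indepS S1 S2 S3 wS).
have nN u w : u \notin K -> w \in K -> w \notin F u -> w \in N u.
  move=> uK wK; rewrite !inE negb_and !negbK => /orP[/eqP uw|//].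
  by rewrite uw wK in uK.
have : #|K :&: F u2 :&: F u3| <= #|K :&: N u1|.
  apply: subset_leq_card; apply/subsetP => w; rewrite !in_setI.
  case/andP=> /andP[wK w2] w3; rewrite wK nN //.
  by apply/negP => w1; apply: (no4 w).
have : #|K :&: F u1 :&: F u3| <= #|K :&: F u1 :&: N u2|.
  apply: subset_leq_card; apply/subsetP => w; rewrite !in_setI.
  case/andP=> /andP[wK w1] w3; rewrite wK w1 nN //.
  by apply/negP => w2; apply: (no4 w).
(* Adding the three bounds and [common_sum] gives 3|K| + 46 <= |K| + 138, so |K| <= 46. *)
rewrite (negPf K1) in_setI (negPf K2) /=; lia.
Qed.

(** For three independent vertices, [common_sum] makes some pair share at least 16 neighbors; its
    common non-neighbors form a clique of at least 43 + 16 vertices. *)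
Lemma large_clique_exists :
  exists K : {set T}, [/\ K \subset S, is_clique K & 58 < #|K|].
Proof.
have /card_gt0P[x xS] : 0 < #|S| by rewrite cardS.
have /card_gt0P[y] : 0 < #|S :&: F x| by rewrite card_non_neighbors.
rewrite in_setI => /andP[yS xy].
have /card_gt0P[z] : 0 < #|S :&: F x :&: F y| by rewrite card_non_neighbors2.
rewrite 2!in_setI => /andP[/andP[zS xz] yz].
have sub (U V : {set T}) : S :&: U :&: V \subset S by rewrite -setIA subsetIl.
have := common_sum xS yS zS xy xz yz.
have := card_non_neighbors2 xS yS xy.
have := card_non_neighbors2 xS zS xz.
have := card_non_neighbors2 yS zS yz.
move=> Hyz Hxz Hxy sum.
have [xy16|xy16] := leqP 16 #|S :&: N x :&: N y|.
  by exists (S :&: F x :&: F y); split; rewrite ?sub ?non_neighbors2_clique //; lia.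
have [xz16|xz16] := leqP 16 #|S :&: N x :&: N z|.
  by exists (S :&: F x :&: F z); split; rewrite ?sub ?non_neighbors2_clique //; lia.
by exists (S :&: F y :&: F z); split; rewrite ?sub ?non_neighbors2_clique //; lia.
Qed.

(* Outside a maximal clique [K] no three vertices are pairwise non-adjacent, so
   the rest is covered by two more maximal cliques. *)
Lemma no_local_graph : False.
Proof.
have [K0 [K0S cK0 K0big]] := large_clique_exists.
have [K mK K0K] := max_clique_exists K0S cK0; have [KS cK _] := mK.
have K50 : 50 < #|K| by have := subset_leq_card K0K; lia.
have K73 := cliqueS KS cK.
have cardD : #|S :\: K| = 221 - #|K| by rewrite cardsD (setIidPr KS) cardS.
have : ~~ is_clique (S :\: K).
  by apply/negP => /(cliqueS (subsetDl _ _)); lia.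
case/cliquePn => u1 [u2 []]; rewrite !in_setD => /andP[K1 S1] /andP[K2 S2] f12.
have f21 : u1 \in F u2 by rewrite non_neighborsC.
(* By [no_triple_outside] the non-neighbors of [u] outside [K] form a clique, of size at least 221 -
   73 - 1 - 88 = 59. *)
have ext u : u \in S -> u \notin K ->
    exists M, [/\ max_clique M, (S :\: K) :&: F u \subset M
                & 58 < #|(S :\: K) :&: F u|].
  move=> uS uK; have sub : (S :\: K) :&: F u \subset S.
    by rewrite (subset_trans (subsetIl _ _)) // subsetDl.
  have c : is_clique ((S :\: K) :&: F u).
    apply: contraT => /cliquePn[y [z [+ + yz]]].
    rewrite !in_setI !in_setD => /andP[/andP[yK yS] uy] /andP[/andP[zK zS] uz].
    by case: (no_triple_outside mK K50 uS yS zS uK yK zK uy uz yz).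
  have [M mM subM] := max_clique_exists sub c; exists M; split=> //.
  have := card_split (S :\: K) u; rewrite cardD.
  have : #|(S :\: K) :&: N u| <= 88.
    by rewrite -(degS uS) subset_leq_card // setSI // subsetDl.
  have -> : u \in S :\: K by rewrite in_setD uK uS.
  clear -K73 => /=; lia.
have [M1 [mM1 sub1 big1]] := ext u1 S1 K1.
have [M2 [mM2 sub2 big2]] := ext u2 S2 K2.
have [M1S cM1 _] := mM1; have [M2S cM2 _] := mM2.
(* A vertex [z] outside all three cliques would have at least 59 - 25 = 34 non-neighbors in each of
   the two cliques given by [ext]. *)
have cover z : z \in S -> z \notin K -> (z \in M1) || (z \in M2).
  move=> zS zK; apply: contraT; rewrite negb_or => /andP[zM1 zM2].
  have far M (C : {set T}) : max_clique M -> z \notin M -> C \subset M ->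
      58 < #|C| -> 33 < #|C :&: F z|.
    move=> mM zM CM Cbig; have := card_split C z.
    have : #|C :&: N z| <= 25.
      apply: leq_trans (max_clique_few mM zS zM).
      by rewrite subset_leq_card // setSI.
    have /negPf -> : z \notin C by apply: contra zM; apply: subsetP.
    by move: Cbig; clear; lia.
  have far1 := far _ _ mM1 zM1 sub1 big1; have far2 := far _ _ mM2 zM2 sub2 big2.
  (* By [no_triple_outside], [w] equals or is adjacent to each of the 34 non-neighbors of [z] in the
     second clique, too many for a vertex outside [M2]. *)
  have inM2 w : w \in (S :\: K) :&: F u1 :&: F z -> w \in M2.
    rewrite !in_setI in_setD => /andP[/andP[/andP[wK wS] _] zw].
    apply: contraT => wM2; have := max_clique_few mM2 wS wM2.
    have : #|(S :\: K) :&: F u2 :&: F z| <= #|w |: (M2 :&: N w)|.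
      apply: subset_leq_card; apply/subsetP => y yC.
      have yM2 : y \in M2.
        by apply: (subsetP sub2); move: yC; rewrite in_setI => /andP[].
      move: yC; rewrite !in_setI in_setD => /andP[/andP[/andP[yK yS] _] zy].
      rewrite in_setU1 in_setI yM2 [y \in N w]inE eq_sym.
      have [//|wy] := eqVneq w y; apply: contraT => nwy.
      by case: (no_triple_outside mK K50 zS wS yS zK wK yK zw zy); rewrite inE wy.
    rewrite cardsU1; have := leq_b1 (w \notin M2 :&: N w).
    by move: far2; clear; lia.
  (* The 34 non-neighbors of [z] in the first clique now lie in both [M1] and [M2], so they are
     neighbors in [M2] of [u2], which is in [M1] but not in [M2]. *)
  have u2M1 : u2 \in M1.
    by apply: (subsetP sub1); rewrite in_setI in_setD K2 S2.
  have u1M2 : u1 \in M2.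
    by apply: (subsetP sub2); rewrite in_setI in_setD K1 S1.
  have u2M2 : u2 \notin M2.
    apply/negP => u2M2; move: f12; rewrite inE => /andP[u12].
    by rewrite (cliqueP _ cM2).
  have := max_clique_few mM2 S2 u2M2.
  have : #|(S :\: K) :&: F u1 :&: F z| <= #|M2 :&: N u2|.
    apply: subset_leq_card; apply/subsetP => w wC; have wM2 := inM2 w wC.
    have wM1 : w \in M1.
      by apply: (subsetP sub1); move: wC; rewrite in_setI => /andP[].
    rewrite in_setI wM2 inE (cliqueP _ cM1) //.
    by apply: contraNneq u2M2 => ->.
  by move: far1; clear; lia.
have : #|S| <= #|K :|: (M1 :|: M2)|.
  apply: subset_leq_card; apply/subsetP => z zS; rewrite !in_setU.
  by have [//|zK] := boolP (z \in K); apply: cover.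
have := cliqueS M1S cM1; have := cliqueS M2S cM2.
have [+ _] := leq_card_setU K (M1 :|: M2); have [+ _] := leq_card_setU M1 M2.
by rewrite cardS; move: K73; clear; lia.
Qed.
End LocalGraph.

Import Order.TTheory GRing.Theory Num.Theory.
Local Open Scope ring_scope.

(** * Diagonalization of real symmetric matrices *)

Lemma mulmx_tr_ge0 (R : realDomainType) n (u : 'rV[R]_n) : 0 <= (u *m u^T) 0 0.
Proof. by rewrite mxE sumr_ge0 // => i _; rewrite mxE -expr2 sqr_ge0. Qed.

Lemma mulmx_tr_eq0 (R : realDomainType) n (u : 'rV[R]_n) :
  (u *m u^T) 0 0 = 0 -> u = 0.
Proof.
rewrite mxE => /eqP; rewrite psumr_eq0; last first.
  by move=> i _; rewrite mxE -expr2 sqr_ge0.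
move=> /allP u0; apply/rowP => i; rewrite mxE.
have /eqP := u0 i (mem_index_enum _).
by rewrite mxE -expr2 => /eqP; rewrite sqrf_eq0 => /eqP.
Qed.

(** Take a complex eigenvalue [x + iy] with eigenvector [u + iv]. Symmetry forces [y] times the
    squared norm of [u + iv] to vanish, so [y = 0] and whichever of [u], [v] is nonzero is a real
    eigenvector. *)
Lemma symmetric_eigenvector (R : rcfType) n (A : 'M[R]_n.+1) :
  A^T = A -> exists a (v : 'rV_n.+1), v *m v^T = 1%:M /\ v *m A = a *: v.
Proof.
move=> symA.
suff [a [v [vn0 vA]]] : exists a (v : 'rV_n.+1), v != 0 /\ v *m A = a *: v.
  pose s := Num.sqrt ((v *m v^T) 0 0).
  have s2 : s ^+ 2 = (v *m v^T) 0 0 by rewrite sqr_sqrtr // mulmx_tr_ge0.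
  have sn0 : s != 0.
    apply: contra_neq vn0 => s0; apply: mulmx_tr_eq0.
    by rewrite -s2 s0 expr0n.
  exists a, (s^-1 *: v); split; last by rewrite -scalemxAl vA scalerA mulrC -scalerA.
  rewrite linearZ /= -scalemxAl -scalemxAr scalerA.
  rewrite [v *m _]mx11_scalar -s2 scale_scalar_mx -invfM -expr2 mulVf //.
  by rewrite sqrf_eq0.
pose Ac := map_mx (real_complex R) A.
have [[x y] /eigenvalueP [w wA wn0]] : exists z : R[i], eigenvalue Ac z.
  have /closed_rootP [z rz] : size (char_poly Ac) != 1%N.
    by rewrite size_char_poly.
  by exists z; rewrite eigenvalue_root_char.
pose u := map_mx (@complex.Re R) w; pose v := map_mx (@complex.Im R) w.
have uA : u *m A = x *: u - y *: v.
  apply/rowP => i; move/rowP/(_ i)/(congr1 (@complex.Re R)): wA.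
  rewrite !mxE raddf_sum /= => wA.
  transitivity (\sum_j complex.Re (w 0 j * Ac j i)).
    by apply: eq_bigr => j _; rewrite !mxE; case: (w 0 j) => p q /=; ring.
  by rewrite wA; case: (w 0 i) => p q /=.
have vA : v *m A = x *: v + y *: u.
  apply/rowP => i; move/rowP/(_ i)/(congr1 (@complex.Im R)): wA.
  rewrite !mxE raddf_sum /= => wA.
  transitivity (\sum_j complex.Im (w 0 j * Ac j i)).
    by apply: eq_bigr => j _; rewrite !mxE; case: (w 0 j) => p q /=; ring.
  by rewrite wA; case: (w 0 i) => p q /=.
have uv : (v *m u^T) 0 0 = (u *m v^T) 0 0.
  by rewrite -[v *m u^T]trmxK trmx_mul trmxK [RHS]mxE mxE; rewrite mxE.
have E : (u *m A *m v^T) 0 0 = (v *m A *m u^T) 0 0.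
  by rewrite -[in LHS]symA -mulmxA -trmx_mul -[in LHS](trmxK u) -trmx_mul mxE.
have y0 : y * ((u *m u^T) 0 0 + (v *m v^T) 0 0) = 0.
  move: E; rewrite uA vA mulmxBl mulmxDl -!scalemxAl.
  by rewrite !mxE; move: uv; rewrite !mxE => ->; lra.
have nz : (u *m u^T) 0 0 + (v *m v^T) 0 0 != 0.
  apply: contra_neq wn0 => S0.
  have := mulmx_tr_ge0 u; have := mulmx_tr_ge0 v => v0 u0.
  have /rowP u00 : u = 0 by apply: mulmx_tr_eq0; lra.
  have /rowP v00 : v = 0 by apply: mulmx_tr_eq0; lra.
  apply/rowP => i; move: (u00 i) (v00 i); rewrite !mxE.
  by case: (w 0 i) => p q /= -> ->.
have {}y0 : y = 0 by move/eqP: y0; rewrite mulf_eq0 (negPf nz) orbF => /eqP.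
move: uA vA; rewrite y0 !scale0r subr0 addr0 => uA vA.
have [u0|u0] := eqVneq u 0; last by exists x, u.
have [v0|v0] := eqVneq v 0; last by exists x, v.
by case/eqP: nz; rewrite u0 v0 !mul0mx !mxE addr0.
Qed.

(** The reflection in the hyperplane orthogonal to [u - v] exchanges the two unit vectors;
    [2 - 2 * c] is the squared norm of [u - v]. *)
Lemma householder (R : rcfType) n (u v : 'rV[R]_n) :
  u *m u^T = 1%:M -> v *m v^T = 1%:M ->
  exists H : 'M[R]_n, [/\ H^T = H, H *m H = 1%:M & u *m H = v].
Proof.
move=> uu vv; have [->|uNv] := eqVneq u v.
  by exists 1%:M; split; rewrite ?trmx1 ?mulmx1.
have [w wE] : {w | w = u - v} by exists (u - v).
pose c := (u *m v^T) 0 0.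
have vu : v *m u^T = c%:M.
  by rewrite -[v *m u^T]trmxK trmx_mul trmxK [u *m _]mx11_scalar tr_scalar_mx.
have uv : u *m v^T = c%:M by rewrite [LHS]mx11_scalar.
have ww : w *m w^T = (2 - 2 * c)%:M.
  rewrite wE linearB /= mulmxBl !mulmxBr uu vv uv vu -!raddfB /=.
  by congr (_%:M); ring.
have cn : 2 - 2 * c != 0.
  apply: contra_neq uNv => c0; apply/eqP; rewrite -subr_eq0; apply/eqP.
  by apply: mulmx_tr_eq0; rewrite -wE ww c0 mxE.
pose g := 2 / (2 - 2 * c).
exists (1%:M - g *: (w^T *m w)); split.
- by rewrite linearB /= trmx1 linearZ /= trmx_mul trmxK.
- have PP : w^T *m w *m (w^T *m w) = (2 - 2 * c) *: (w^T *m w).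
    by rewrite mulmxA -(mulmxA _ w) ww mul_mx_scalar -scalemxAl.
  rewrite mulmxBl mul1mx mulmxBr mulmx1 -scalemxAl -scalemxAr PP !scalerA.
  rewrite (_ : g * g * _ = g + g); last by rewrite /g; field.
  by rewrite scalerDl opprB addrK subrK.
- rewrite mulmxBr mulmx1 -scalemxAr mulmxA {1}wE linearB /= mulmxBr uu uv.
  rewrite -raddfB /= mul_scalar_mx scalerA (_ : g * _ = 1) ?scale1r.
    by rewrite wE opprB addrC subrK.
  by rewrite /g; field.
Qed.

(** Induction on the size: a reflection sends a unit eigenvector to the first basis vector, and
    conjugating by it splits off a 1 by 1 block. *)
Lemma symmetric_diagonalization (R : rcfType) n (A : 'M[R]_n) :
  A^T = A ->
  exists (Q : 'M[R]_n) (d : 'rV[R]_n),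
    Q *m Q^T = 1%:M /\ A = Q^T *m diag_mx d *m Q.
Proof.
elim: n A => [|n IHn] A symA.
  by exists 1%:M, 0; split; apply/matrixP => [[]].
have [a [v [v1 vA]]] := symmetric_eigenvector symA.
pose e : 'rV[R]_(1 + n) := row_mx 1%:M 0.
have e1 : e *m e^T = 1%:M.
  by rewrite tr_row_mx mul_row_col trmx1 mulmx1 mul0mx addr0.
have [H [symH HH vH]] := householder v1 e1.
have eH : e *m H = v by rewrite -vH -mulmxA HH mulmx1.
pose A1 : 'M[R]_(1 + n) := H *m A *m H.
have symA1 : A1^T = A1 by rewrite /A1 !trmx_mul symA symH mulmxA.
have eA1 : e *m A1 = a *: e.
  by rewrite /A1 !mulmxA eH vA -scalemxAl vH.
have [B symB A1E] : exists2 B : 'M[R]_n, B^T = B & A1 = block_mx a%:M 0 0 B.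
  have A1E := esym (submxK A1).
  move: eA1; rewrite {1}A1E mul_row_block !mul1mx !mul0mx !addr0.
  rewrite scale_row_mx scaler0 => /eq_row_mx [ulE urE].
  move: symA1; rewrite {1 2}A1E tr_block_mx => /eq_block_mx [_ _ dlE symB].
  exists (drsubmx A1) => //; apply: (etrans A1E).
  by rewrite -dlE urE ulE scalemx1 trmx0.
have [Q [d [QQ BE]]] := IHn _ symB.
pose Q1 : 'M[R]_(1 + n) := block_mx 1%:M 0 0 Q.
pose d1 : 'rV[R]_(1 + n) := row_mx a%:M d.
have QQ1 : Q1 *m Q1^T = 1%:M.
  rewrite tr_block_mx !trmx0 trmx1 mulmx_block !mulmx0 !mul0mx !mulmx1.
  by rewrite QQ !addr0 add0r -scalar_mx_block.
have {}A1E : A1 = Q1^T *m diag_mx d1 *m Q1.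
  rewrite A1E diag_mx_row tr_block_mx !trmx0 trmx1 !mulmx_block.
  rewrite !mulmx0 !mul0mx !mulmx1 !mul1mx !addr0 !add0r -BE.
  congr block_mx; rewrite ?mul0mx ?mulmx0 //.
  by apply/matrixP=> i j; rewrite !ord1 !mxE.
exists (Q1 *m H), d1; rewrite trmx_mul symH; split.
  by rewrite mulmxA -(mulmxA _ H H) HH mulmx1.
rewrite -!mulmxA (mulmxA Q1^T) (mulmxA _ _ H) -A1E /A1.
by rewrite !mulmxA HH mul1mx -mulmxA HH mulmx1.
Qed.

(** * Dot products and orthogonally diagonalized matrices *)

Definition dot (R : pzRingType) n (u v : 'rV[R]_n) : R := \sum_i u 0 i * v 0 i.

Lemma dotE (R : pzRingType) n (u v : 'rV[R]_n) : (u *m v^T) 0 0 = dot u v.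
Proof. by rewrite mxE; apply: eq_bigr => i _; rewrite mxE. Qed.

Lemma dotC (R : comPzRingType) n (u v : 'rV[R]_n) : dot u v = dot v u.
Proof. by apply: eq_bigr => i _; rewrite mulrC. Qed.

Lemma dotDl (R : pzRingType) n (u v w : 'rV[R]_n) :
  dot (u + v) w = dot u w + dot v w.
Proof. by rewrite -big_split; apply: eq_bigr => i _; rewrite mxE mulrDl. Qed.

Lemma dotZl (R : pzRingType) n a (u v : 'rV[R]_n) :
  dot (a *: u) v = a * dot u v.
Proof. by rewrite mulr_sumr; apply: eq_bigr => i _; rewrite mxE mulrA. Qed.

Lemma dotDr (R : pzRingType) n (u v w : 'rV[R]_n) :
  dot w (u + v) = dot w u + dot w v.
Proof. by rewrite -big_split; apply: eq_bigr => i _; rewrite mxE mulrDr. Qed.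

Lemma dotZr (R : comPzRingType) n a (u v : 'rV[R]_n) :
  dot u (a *: v) = a * dot u v.
Proof. by rewrite dotC dotZl dotC. Qed.

Lemma dot_mulmx (R : comPzRingType) n (A : 'M[R]_n) (u v : 'rV[R]_n) :
  dot (u *m A) v = dot u (v *m A^T).
Proof. by rewrite -!dotE trmx_mul trmxK mulmxA. Qed.

Lemma dot_ge0 (R : realDomainType) n (u : 'rV[R]_n) : 0 <= dot u u.
Proof. by rewrite -dotE mulmx_tr_ge0. Qed.

Lemma dot_gt0 (R : realDomainType) n (u : 'rV[R]_n) : u != 0 -> 0 < dot u u.
Proof.
move=> un0; rewrite lt0r dot_ge0 andbT; apply: contra_neq un0 => u0.
by apply: mulmx_tr_eq0; rewrite dotE.
Qed.

Lemma mxtrace_dyad (R : comNzRingType) n (u v : 'rV[R]_n) :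
  \tr (u^T *m v) = dot u v.
Proof. by apply: eq_bigr => i _; rewrite !mxE big_ord1 !mxE. Qed.

(** [E] selects the rows with nonzero diagonal entry: the matrix factors through [E], and its
    compression by [E] is invertible. *)
Lemma rank_diag_mx (F : fieldType) n (d : 'rV[F]_n) :
  \rank (diag_mx d) = #|[pred i | d 0 i != 0]|.
Proof.
set I := [pred i | _]; pose f (i : 'I_#|I|) := enum_val i.
pose E : 'M[F]_(#|I|, n) := rowsub f 1%:M.
have ED i h : (E *m diag_mx d) i h = (f i == h)%:R * d 0 h.
  by rewrite mul_mx_diag !mxE.
have EE : E *m diag_mx d *m E^T = diag_mx (\row_i d 0 (f i)).
  apply/matrixP => i j; rewrite !mxE (bigD1 (f i)) //= big1 => [|h hi].
    rewrite ED !mxE eqxx mul1r addr0 (inj_eq enum_val_inj) eq_sym.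
    by case: eqP => [->|]; rewrite ?mulr1 ?mulr0 ?mulr1n.
  by rewrite ED eq_sym (negPf hi) !mul0r.
have dE : diag_mx d = E^T *m (E *m diag_mx d).
  apply/matrixP => i j; rewrite !mxE.
  have [Ii|Ii] := boolP (i \in I).
    rewrite (bigD1 (enum_rank_in Ii i)) //= big1 => [|h hi].
      rewrite ED !mxE /f enum_rankK_in // eqxx mul1r addr0.
      by rewrite eq_sym; case: eqP => [->|]; rewrite ?mul1r ?mul0r.
    rewrite !mxE /f; case: eqP => [hi'|]; rewrite ?mul0r //.
    by case/eqP: hi; apply: enum_val_inj; rewrite hi' enum_rankK_in.
  move: (Ii); rewrite inE negbK => /eqP ->; rewrite mul0rn big1 // => h _.
  rewrite !mxE; case: eqP => [hi|]; rewrite ?mul0r //.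
  by move: (enum_valP h); rewrite -/(f h) hi (negPf Ii).
apply/eqP; rewrite eqn_leq; apply/andP; split.
  by rewrite {1}dE (leq_trans (mxrankM_maxl _ _)) // rank_leq_col.
have <- : \rank (diag_mx (\row_i d 0 (f i))) = #|I|.
  apply/eqP; rewrite -[_ == _]/(row_free _) row_free_unit unitmxE det_diag.
  rewrite unitfE; apply/prodf_neq0 => i _; rewrite mxE.
  by have := enum_valP i; rewrite inE.
by rewrite -EE (leq_trans (mxrankM_maxl _ _)) // mxrankM_maxr.
Qed.

Section Diagonalized.
Variables (R : rcfType) (n : nat) (A Q : 'M[R]_n) (d : 'rV[R]_n).
Hypotheses (QQ : Q *m Q^T = 1%:M) (AE : A = Q^T *m diag_mx d *m Q).

Let QtQ : Q^T *m Q = 1%:M.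
Proof. exact: mulmx1C. Qed.

Lemma diagonalized_trace : \tr A = \sum_i d 0 i.
Proof. by rewrite AE mxtrace_mulC mulmxA QQ mul1mx mxtrace_diag. Qed.

Lemma diagonalized_sqr : A *m A = Q^T *m diag_mx (\row_i d 0 i ^+ 2) *m Q.
Proof.
rewrite AE !mulmxA -(mulmxA _ Q) QQ mulmx1 -(mulmxA Q^T) mulmx_diag.
by congr (_ *m diag_mx _ *m _); apply/rowP => i; rewrite !mxE expr2.
Qed.

Lemma diagonalized_eigenvector i : row i Q *m A = d 0 i *: row i Q.
Proof.
rewrite AE !mulmxA -!row_mul QQ row_mul mul1mx; apply/rowP => j.
by rewrite !mxE (bigD1 i) //= big1 => [|h hi]; rewrite !mxE ?eqxx ?addr0 //
  eq_sym (negPf hi) mul0r.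
Qed.

Lemma diagonalized_row_neq0 i : row i Q != 0.
Proof.
apply: contra_eq_neq (congr1 (fun B : 'M_n => B i i) QQ) => Q0.
rewrite !mxE eqxx big1 => [|j _]; first by rewrite eq_sym oner_neq0.
by move/rowP/(_ j): Q0; rewrite !mxE => ->; rewrite mul0r.
Qed.

Lemma diagonalized_rank : \rank A = #|[pred i | d 0 i != 0]|.
Proof.
rewrite -rank_diag_mx AE mxrankMfree; last first.
  by rewrite row_free_unit; case/mulmx1_unit: QQ.
by rewrite eqmxMfull // row_full_unit; case/mulmx1_unit: QQ.
Qed.

Lemma diagonalized_form x :
  dot (x *m A) x = \sum_i d 0 i * dot x (row i Q) ^+ 2.
Proof.
have xQ i : (x *m Q^T) 0 i = dot x (row i Q).
  by rewrite mxE; apply: eq_bigr => j _; rewrite !mxE.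
rewrite AE !mulmxA dot_mulmx mul_mx_diag; apply: eq_bigr => i _.
by rewrite mxE !xQ mulrAC mulrC -expr2.
Qed.

End Diagonalized.

(** Every eigenvalue satisfies [d ^+ 2 = rho * d], hence is 0 or [rho]. *)
Lemma rank_scaled_idempotent (R : rcfType) n (P : 'M[R]_n) rho :
  P^T = P -> 0 < rho -> P *m P = rho *: P -> (\rank P)%:R * rho = \tr P.
Proof.
move=> symP rho0 PP; have [Q [d [QQ PE]]] := symmetric_diagonalization symP.
rewrite (diagonalized_rank QQ PE) (diagonalized_trace QQ PE).
rewrite -sum1_card natr_sum mulr_suml big_mkcond; apply: eq_bigr => i _.
rewrite inE mul1r.
have ev := diagonalized_eigenvector QQ PE i.
have : (d 0 i * d 0 i - rho * d 0 i) *: row i Q == 0.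
  rewrite scalerBl -!scalerA -ev scalemxAl -ev -mulmxA PP -scalemxAr ev.
  by rewrite subrr.
rewrite scaler_eq0 (negPf (diagonalized_row_neq0 QQ i)) orbF subr_eq0.
have [->|dn0] := eqVneq (d 0 i) 0; first by [].
by rewrite (inj_eq (mulIf dn0)) => /eqP.
Qed.

(** * The local gap inequality *)

(** The right-hand side is the squared Frobenius norm of [X - 2 *: Y] divided by [4 * rho ^+ 2].
    Here [X] is the symmetrized product of row [a] of [M] with [u *m M], and [Y] is the combination,
    with coefficients [x], of the squares of the rows of [M]. *)
Lemma projection_frobenius (R : rcfType) n (M : 'M[R]_n) rho a (u x : 'rV_n) :
  M^T = M -> 0 < rho -> M *m M = rho *: M ->
  0 <= (M a a * dot (u *m M) u + (u *m M) 0 a ^+ 2) / 2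
       - 2 * \sum_i M a i * (u *m M) 0 i * x 0 i
       + \sum_i \sum_j x 0 i * x 0 j * M i j ^+ 2.
Proof.
move=> symM rho0 MM; set w := u *m M; pose p := row a M.
have uM : u *m M = w by [].
set S := \sum_i M a i * _ * _; set T := \sum_i \sum_j _.
have wM : w *m M = rho *: w by rewrite -uM -mulmxA MM scalemxAr.
have pM : p *m M = rho *: p by rewrite /p -row_mul MM linearZ.
have pp : dot p p = rho * M a a.
  transitivity ((M *m M) a a); last by rewrite MM mxE.
  rewrite [RHS]mxE.
  by apply: eq_bigr => i _; rewrite !mxE -[in X in _ * X]symM mxE.
have ww : dot w w = rho * dot w u.
  by rewrite -{2}uM dotC dot_mulmx symM wM dotZr dotC.
clearbody w; have pw : dot p w = rho * w 0 a.
  transitivity ((w *m M) 0 a); last by rewrite wM mxE.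
  rewrite [RHS]mxE.
  by apply: eq_bigr => i _; rewrite !mxE mulrC -[in X in _ * X]symM mxE.
have pE i : p 0 i = M a i by rewrite mxE.
clearbody p; pose D := diag_mx x; pose X := p^T *m w + w^T *m p; pose Y := M *m D *m M.
have XX : \tr (X *m X) = 2 * rho ^+ 2 * (M a a * dot w u + w 0 a ^+ 2).
  rewrite /X mulmxDl !mulmxDr !mulmxA -!(mulmxA _ w) -!(mulmxA _ p).
  rewrite [w *m p^T]mx11_scalar [w *m w^T]mx11_scalar.
  rewrite [p *m p^T]mx11_scalar [p *m w^T]mx11_scalar !dotE.
  rewrite !mul_mx_scalar -!scalemxAl !raddfD /= !linearZ /= !mxtrace_dyad.
  by rewrite pp ww pw dotC pw; ring.
have XY : \tr (X *m Y) = 2 * rho ^+ 2 * S.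
  have E (v z : 'rV_n) : v *m M = rho *: v -> z *m M = rho *: z ->
      \tr (v^T *m z *m Y) = rho ^+ 2 * \sum_i v 0 i * z 0 i * x 0 i.
    move=> vM zM; rewrite -mulmxA mxtrace_dyad /Y !mulmxA dotC dot_mulmx symM vM.
    rewrite zM -scalemxAl dotZl dotZr mulrA expr2; congr (_ * _).
    by apply: eq_bigr => i _; rewrite mul_mx_diag !mxE; ring.
  rewrite /X mulmxDl raddfD /= !E // -mulrDr -mulrA mulrCA; congr (_ * _).
  rewrite -big_split /S mulr_sumr; apply: eq_bigr => i _ /=.
  by rewrite !pE; ring.
have YY : \tr (Y *m Y) = rho ^+ 2 * T.
  rewrite /Y !mulmxA -(mulmxA _ M M) MM mxtrace_mulC !mulmxA MM.
  rewrite -!(scalemxAl, scalemxAr) !linearZ /= mulrA expr2; congr (_ * _).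
  apply: eq_bigr => i _; rewrite -mulmxA mxE; apply: eq_bigr => j _.
  by rewrite !mul_mx_diag !mxE -[in M j i]symM mxE; ring.
have symXY : (X - 2 *: Y)^T = X - 2 *: Y.
  rewrite linearB linearZ /= /X /Y linearD /= !trmx_mul !trmxK symM tr_diag_mx.
  by rewrite [w^T *m p + _]addrC mulmxA.
have : 0 <= \tr ((X - 2 *: Y) *m (X - 2 *: Y)).
  rewrite sumr_ge0 // => i _; rewrite -{2}symXY mxE sumr_ge0 // => j _.
  by rewrite [_^T _ _]mxE -expr2 sqr_ge0.
rewrite mulmxBl !mulmxBr -!(scalemxAl, scalemxAr) !raddfB /= !linearZ /=.
rewrite [\tr (Y *m X)]mxtrace_mulC XX XY YY => H.
have rho2 : 0 < 4 * rho ^+ 2 by rewrite mulr_gt0 // exprn_gt0.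
rewrite -(pmulr_rge0 _ rho2).
by move: H; congr (_ <= _); field.
Qed.

Definition adjmx (R : pzSemiRingType) n (adj : rel 'I_n) : 'M[R]_n :=
  \matrix_(i, j) (adj i j)%:R.

(** The subtracted term is [rho] times the projection onto the line of row [a] of [M], a line inside
    the image of [M]. *)
Lemma deflation (F : fieldType) n (M : 'M[F]_n) rho a :
  M^T = M -> M *m M = rho *: M -> M a a != 0 ->
  let P := M - (M a a)^-1 *: ((row a M)^T *m row a M) in
  [/\ P^T = P, P *m P = rho *: P & \tr P = \tr M - rho].
Proof.
move=> symM MM Maa P; rewrite {}/P.
have [p pE] : {p | p = row a M} by exists (row a M).
rewrite -pE; have pM : p *m M = rho *: p by rewrite pE -row_mul MM linearZ.
have Mp : M *m p^T = rho *: p^T by rewrite -{1}symM -trmx_mul pM linearZ.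
have pp : dot p p = rho * M a a.
  transitivity ((M *m M) a a); last by rewrite MM mxE.
  rewrite [RHS]mxE; apply: eq_bigr => i _.
  by rewrite pE mxE -{2}symM mxE.
split.
- by rewrite linearB linearZ /= symM trmx_mul trmxK.
- rewrite mulmxBl !mulmxBr MM -!scalemxAl -!scalemxAr.
  rewrite !mulmxA Mp -(mulmxA _ p M) pM -(mulmxA _ p p^T).
  rewrite [p *m p^T]mx11_scalar dotE pp mul_mx_scalar -!(scalemxAl, scalemxAr).
  by apply/matrixP => i j; rewrite !mxE; field.
- by rewrite raddfB /= linearZ /= mxtrace_dyad pp; field.
Qed.

(** * The local graph of a strongly regular graph *)

Section AdjacencyMatrix.
Variables (R : rcfType) (n : nat) (adj : rel 'I_n) (k l m : nat).
Hypothesis srg : strongly_regular adj n k l m.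
Let A : 'M[R]_n := adjmx R adj.

Lemma adjmx_sym : A^T = A.
Proof.
have [[symA _] _ _ _ _] := srg.
by apply/matrixP => i j; rewrite !mxE symA.
Qed.

Lemma card_common_neighborsE i j :
  #|common_neighbors adj i j|%:R = (A *m A) i j.
Proof.
have [[symA _] _ _ _ _] := srg.
rewrite mxE -sum1_card natr_sum big_mkcond; apply: eq_bigr => h _.
by rewrite !inE !mxE (symA j) -natrM mulnb; case: (_ && _).
Qed.

Lemma common_neighbors_id i : common_neighbors adj i i = neighbors adj i.
Proof. by rewrite /common_neighbors setIid. Qed.

Lemma adjmx_sqr :
  A *m A = (k%:R - m%:R)%:M + (l%:R - m%:R) *: A + const_mx m%:R.
Proof.
have [[symA irrA] _ regA adjA nadjA] := srg.
apply/matrixP => i j; rewrite -card_common_neighborsE !mxE.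
have [->|ij] := eqVneq i j.
  by rewrite common_neighbors_id regA irrA mulr0 addr0 mulr1n subrK.
have [aij|aij] := boolP (adj i j).
  by rewrite adjA // mulr0n add0r mulr1 subrK.
by rewrite nadjA // mulr0n add0r mulr0 add0r.
Qed.

Lemma adjmx_rowsum i : \sum_j A i j = k%:R.
Proof.
have [_ _ regA _ _] := srg.
rewrite -(regA i) -sum1_card natr_sum [RHS]big_mkcond; apply: eq_bigr => j _.
by rewrite !inE mxE; case: adj.
Qed.

Lemma sum_mulmx_adjmx (u : 'rV[R]_n) :
  \sum_j (u *m A) 0 j = k%:R * \sum_j u 0 j.
Proof.
under eq_bigr do rewrite mxE.
rewrite exchange_big mulr_sumr; apply: eq_bigr => i _ /=.
by rewrite -mulr_sumr adjmx_rowsum mulrC.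
Qed.

Lemma mulmx_const (a : R) (u : 'rV[R]_n) :
  u *m const_mx a = const_mx (a * \sum_j u 0 j) :> 'rV[R]_n.
Proof.
apply/rowP => i; rewrite !mxE mulr_sumr; apply: eq_bigr => j _.
by rewrite mxE mulrC.
Qed.

Lemma mulmx_adjmx_sqr (u : 'rV[R]_n) : \sum_j u 0 j = 0 ->
  u *m A *m A = (k%:R - m%:R) *: u + (l%:R - m%:R) *: (u *m A).
Proof.
move=> u0; rewrite -mulmxA adjmx_sqr !mulmxDr mul_mx_scalar -scalemxAr.
by rewrite mulmx_const u0 mulr0; apply/rowP => i; rewrite !mxE addr0.
Qed.

(* [rho], [c] and [kap] stand for $r+3$, $(k+3)/v$ and $(\lambda+3)/k$, where
   $r$ and $-3$ are the two restricted eigenvalues. *)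
Variables rho c kap : R.
Hypothesis rho_gt0 : 0 < rho.
Hypothesis rho_lm : l%:R - m%:R = rho - 6.
Hypothesis rho_km : k%:R - m%:R = 3 * (rho - 3).
Hypothesis cE : c * n%:R = k%:R + 3.
Hypothesis mE : m%:R = c * (k%:R - (rho - 3)).
Hypothesis c_lt3 : c < 3.
Hypothesis kapE : kap * k%:R = l%:R + 3.
Hypothesis kap_c : (kap - c) * (3 - c) = (1 - c) ^+ 2.

(* [rho] times the projection onto the [r]-eigenspace. *)
Let M : 'M[R]_n := A + 3%:M - const_mx c.

Lemma eigenproj_sym : M^T = M.
Proof.
rewrite linearB linearD /= adjmx_sym tr_scalar_mx; congr (_ - _).
by apply/matrixP => i j; rewrite !mxE.
Qed.

(** [A + 3%:M] is 0 on the eigenspace for -3 and [rho] on the other restricted one, while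
    [const_mx c] cancels its value [k + 3] on constants. The proof verifies this by expanding with
    [adjmx_sqr]. *)
Lemma eigenproj_sqr : M *m M = rho *: M.
Proof.
pose J : 'M[R]_n := const_mx c; pose kJ : 'M[R]_n := const_mx (k%:R * c).
have symJ : J^T = J by apply/matrixP => i j; rewrite !mxE.
have AJ : A *m J = kJ.
  apply/matrixP => i j; rewrite mxE [RHS]mxE -(adjmx_rowsum i) mulr_suml.
  by apply: eq_bigr => h _; rewrite [J h j]mxE.
have JA : J *m A = kJ.
  rewrite -[LHS]trmxK trmx_mul adjmx_sym symJ AJ.
  by apply/matrixP => i j; rewrite !mxE.
have JJ : J *m J = (k%:R + 3) *: J.
  apply/matrixP => i j; rewrite mxE -cE !mxE.
  under eq_bigr do rewrite !mxE.
  by rewrite sumr_const card_ord -mulr_natr; ring.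
rewrite /M -/J mulmxBl !mulmxBr !mulmxDl !mulmxDr adjmx_sqr AJ JA JJ.
rewrite !mul_mx_scalar !mul_scalar_mx.
apply/matrixP => i j; rewrite !mxE rho_lm rho_km.
by rewrite mE; case: eqP => _; rewrite ?mulr1n ?mulr0n; ring.
Qed.

(* The matrix $B + 3I - \kappa J$ of the local graph at [a], extended by zero
   to all vertices. *)
Definition localmx a : 'M[R]_n :=
  \matrix_(i, j)
    ((adj a i)%:R * (A i j + 3 *+ (i == j) - kap) * (adj a j)%:R).

Lemma localmx_sym a : (localmx a)^T = localmx a.
Proof.
have [[symA _] _ _ _ _] := srg.
by apply/matrixP => i j; rewrite !mxE (symA i) [i == j]eq_sym; ring.
Qed.

Lemma sum_adj a : \sum_i (adj a i)%:R = k%:R :> R.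
Proof. by rewrite -(adjmx_rowsum a); apply: eq_bigr => i _; rewrite mxE. Qed.

Lemma sum_adj_adjmx a i : adj a i -> \sum_j (adj a j)%:R * A i j = l%:R.
Proof.
have [[symA _] _ _ adjA _] := srg.
move=> ai; rewrite -(adjA a i) // card_common_neighborsE mxE.
by apply: eq_bigr => j _; rewrite !mxE (symA i).
Qed.

Lemma sum_adj_diag a i (x : R) :
  \sum_j (adj a j)%:R * (x *+ (i == j)) = (adj a i)%:R * x.
Proof.
rewrite (bigD1 i) //= eqxx big1 => [|j ji]; first by rewrite addr0 mulr1n.
by rewrite eq_sym (negPf ji) mulr0.
Qed.

Lemma localmx_trace a : \tr (localmx a) = k%:R * (3 - kap).
Proof.
have [[_ irrA] _ _ _ _] := srg.
rewrite -(sum_adj a) mulr_suml; apply: eq_bigr => i _.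
rewrite !mxE irrA eqxx add0r mulrAC -natrM.
by case: adj; rewrite /= ?mul0r ?mulr0.
Qed.

(** Within the neighborhood each row has one entry [3 - kap], [l] entries [1 - kap], and [- kap]
    elsewhere. *)
Lemma localmx_sqr_trace a : \tr (localmx a *m localmx a) =
  k%:R * (3 - kap) ^+ 2 + k%:R * l%:R * (1 - kap) ^+ 2
  + k%:R * (k%:R - 1 - l%:R) * kap ^+ 2.
Proof.
have [[_ irrA] _ _ _ _] := srg.
pose f : R := ((3 - kap) ^+ 2 - kap ^+ 2)
  + l%:R * ((1 - kap) ^+ 2 - kap ^+ 2) + k%:R * kap ^+ 2.
transitivity (\sum_i (adj a i)%:R * f); last first.
  by rewrite -mulr_suml sum_adj /f; ring.
apply: eq_bigr => i _; rewrite mxE.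
have [ai|nai] := boolP (adj a i); last first.
  by rewrite mul0r big1 // => j _; rewrite mxE (negPf nai) !mul0r.
rewrite mul1r /f -(sum_adj a) -(sum_adj_adjmx ai) !mulr_suml.
have := sum_adj_diag a i ((3 - kap) ^+ 2 - kap ^+ 2).
rewrite ai mul1r => <-; rewrite -!big_split; apply: eq_bigr => j _ /=.
have -> : localmx a j i = localmx a i j by rewrite -[in LHS]localmx_sym mxE.
rewrite !mxE ai.
have [->|ij] := eqVneq i j; first by rewrite irrA; case: adj => /=; ring.
by case: (adj i j); case: (adj a j) => /=; ring.
Qed.

(** Hypothesis [kap_c] says exactly that [localmx a] is [M], deflated at [a], cut down to the
    neighborhood of [a]. Its rank is thus at most that of the deflation, one less than the rank of
    [M]. *)
Lemma localmx_rank a :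
  (\rank (localmx a))%:R * rho <= n%:R * (3 - c) - rho.
Proof.
have [[_ irrA] _ _ _ _] := srg.
have c3 : 3 - c != 0 by rewrite subr_eq0 eq_sym lt_eqF.
have Maa : M a a = 3 - c by rewrite !mxE irrA eqxx add0r mulr1n.
pose P := M - (M a a)^-1 *: ((row a M)^T *m row a M).
have [symP PP trP] : [/\ P^T = P, P *m P = rho *: P & \tr P = \tr M - rho].
  by apply: deflation; rewrite ?Maa ?eigenproj_sym ?eigenproj_sqr.
have {}trP : \tr P = n%:R * (3 - c) - rho.
  rewrite trP; congr (_ - _); transitivity (\sum_(i < n) (3 - c)).
    by apply: eq_bigr => i _; rewrite !mxE irrA eqxx add0r mulr1n.
  by rewrite sumr_const card_ord mulr_natl.
pose D : 'M[R]_n := diag_mx (row a A).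
have -> : localmx a = D *m P *m D.
  have kapB : kap = c + (3 - c)^-1 * (1 - c) ^+ 2 by rewrite -kap_c; field.
  apply/matrixP => i j.
  rewrite mul_mx_diag mul_diag_mx /P Maa !mxE big_ord1 !mxE kapB.
  case: (boolP (adj a i)) => [ai|_]; last by rewrite !mul0r.
  case: (boolP (adj a j)) => [aj|_]; last by rewrite !mulr0.
  have [ia|_] := eqVneq a i; first by rewrite ia irrA in ai.
  have [ja|_] := eqVneq a j; first by rewrite ja irrA in aj.
  by rewrite /= !mulr0n; field.
rewrite -trP -(rank_scaled_idempotent symP rho_gt0 PP) ler_pM2r // ler_nat.
by rewrite (leq_trans (mxrankM_maxl _ _)) // mxrankM_maxr.
Qed.

(** By [kapE] the rows of [localmx a] sum to zero, so an eigenvector with nonzero eigenvalue is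
    orthogonal to constants; the [kap] term then drops out. *)
Lemma localmx_eigenvector a (u : 'rV[R]_n) d :
  u *m localmx a = d *: u -> d != 0 ->
  [/\ forall i, ~~ adj a i -> u 0 i = 0, \sum_i u 0 i = 0
    & forall i, adj a i -> (u *m A) 0 i = (d - 3) * u 0 i].
Proof.
move=> ud dn0.
have supp i : ~~ adj a i -> u 0 i = 0.
  move=> ai; move/rowP/(_ i): ud; rewrite !mxE big1 => [/esym/eqP|j _].
    by rewrite mulf_eq0 (negPf dn0) => /eqP.
  by rewrite !mxE (negPf ai) !mulr0.
have sum0 : \sum_i u 0 i = 0.
  apply: (mulfI dn0); rewrite mulr0 mulr_sumr.
  transitivity (\sum_j (u *m localmx a) 0 j).
    by apply: eq_bigr => j _; rewrite ud mxE.
  under eq_bigr do rewrite mxE.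
  rewrite exchange_big big1 //= => i _; rewrite -mulr_sumr.
  have [ai|/supp ->] := boolP (adj a i); last by rewrite mul0r.
  rewrite (_ : \sum_j _ = 0) ?mulr0 //.
  transitivity (\sum_j ((adj a j)%:R * A i j + (adj a j)%:R * (3 *+ (i == j))
                        - kap * (adj a j)%:R)).
    by apply: eq_bigr => j _; rewrite !mxE ai; case: (i == j) => /=; ring.
  rewrite sumrB big_split /= sum_adj_adjmx // sum_adj_diag ai -mulr_sumr sum_adj.
  by rewrite kapE mul1r subrr.
split => // i ai; move/rowP/(_ i): ud; rewrite [LHS]mxE [RHS]mxE.
have -> : \sum_j u 0 j * localmx a j i = (u *m A) 0 i + 3 * u 0 i.
  transitivity (\sum_j (u 0 j * A j i + (u 0 j * (3 *+ (i == j)))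
                        - kap * u 0 j)).
    apply: eq_bigr => j _; rewrite !mxE ai eq_sym.
    by have [_|/supp ->] := boolP (adj a j); case: (i == j) => /=; ring.
  rewrite sumrB big_split /= -mulr_sumr sum0 mulr0 subr0 [in RHS]mxE.
  congr (_ + _); rewrite (bigD1 i) //= eqxx big1 => [|j ji].
    by rewrite addr0 mulr1n mulrC.
  by rewrite eq_sym (negPf ji) mulr0.
by move=> H; rewrite mulrBl -H; ring.
Qed.

(* [g1] and [g2] are the coefficients, on the neighbors and on the non-neighbors
   of [a], of the combination of squares compared with [u_a w]; [e]
   is the squared norm of [u *m A] outside the neighborhood of [a], relative to
   that of [u].  The applications take [g1] and [g2] at minimal distance. *)
Lemma localmx_spectrum a (u : 'rV[R]_n) d :
  u *m localmx a = d *: u -> u != 0 -> d != 0 ->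
  [/\ 0 < d, d <= rho
    & forall g1 g2 e : R, e = (rho - d) * d ->
      0 <= (3 - c) * d / 2 - 2 * ((1 - c) * d * g1 - c * e * g2)
        + (9 - 6 * c) * (g1 ^+ 2 + e * g2 ^+ 2)
        + (1 - 2 * c) * ((d - 3) * g1 ^+ 2 + 2 * e * g1 * g2
                         + (rho - 3 - d) * e * g2 ^+ 2)].
Proof.
have [[symA irrA] _ _ _ _] := srg.
move=> ud un0 dn0; have [supp sum0 uA] := localmx_eigenvector ud dn0.
(* [w] is the part of [u *m A] outside the neighborhood of [a]. *)
have s0 := dot_gt0 un0; pose w := u *m A - (d - 3) *: u.
have uAE : u *m A = (d - 3) *: u + w by rewrite addrC subrK.
have wE i : w 0 i = (u *m A) 0 i - (d - 3) * u 0 i by rewrite !mxE.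
have ws i : adj a i -> w 0 i = 0 by move=> ai; rewrite wE uA // subrr.
have ua : u 0 a = 0 by rewrite supp // irrA.
have wa : w 0 a = 0.
  rewrite wE ua mulr0 subr0 -[RHS]sum0 mxE; apply: eq_bigr => i _.
  rewrite mxE symA; have [_|/supp ->] := boolP (adj a i); first by rewrite mulr1.
  by rewrite mul0r.
have sumw : \sum_i w 0 i = 0.
  under eq_bigr do rewrite wE.
  by rewrite sumrB sum_mulmx_adjmx -mulr_sumr sum0 !mulr0 subrr.
clearbody w.
have wA : w *m A = (3 * (rho - 3)) *: u + (rho - 3 - d) *: (u *m A).
  have -> : w = u *m A - (d - 3) *: u by rewrite uAE addrC addKr.
  rewrite mulmxBl mulmx_adjmx_sqr // rho_km rho_lm -scalemxAl.
  by apply/rowP => i; rewrite !mxE; ring.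
have uw : dot u w = 0.
  rewrite /dot big1 // => i _.
  by have [/ws ->|/supp ->] := boolP (adj a i); rewrite ?mulr0 ?mul0r.
have ww : dot w w = (rho - d) * d * dot u u.
  transitivity (dot (u *m A) w); first by rewrite uAE dotDl dotZl uw mulr0 add0r.
  rewrite dot_mulmx adjmx_sym wA uAE !(dotDr, dotZr) uw; ring.
have uM : u *m M = d *: u + w.
  rewrite /M mulmxBr mulmxDr mulmx_const sum0 mulr0 uAE mul_mx_scalar.
  by apply/rowP => i; rewrite !mxE; ring.
have Maa : M a a = 3 - c by rewrite !mxE irrA eqxx add0r mulr1n.
have uMu : dot (u *m M) u = d * dot u u.
  by rewrite uM dotDl dotZl [dot w u]dotC uw addr0.
have d0 : 0 < d.
  rewrite lt0r dn0 /= -(pmulr_lge0 _ s0) -uMu -(pmulr_rge0 _ rho_gt0).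
  have -> : rho * dot (u *m M) u = dot (u *m M) (u *m M).
    by rewrite [RHS]dot_mulmx eigenproj_sym -mulmxA eigenproj_sqr -scalemxAr
      dotZr dotC.
  exact: dot_ge0.
split => //.
  have := dot_ge0 w; rewrite ww pmulr_lge0 // pmulr_lge0 //.
  by rewrite subr_ge0.
move=> g1 g2 e eE; pose x := g1 *: u + g2 *: w.
have xE i : x 0 i = g1 * u 0 i + g2 * w 0 i by rewrite !mxE.
have := projection_frobenius a u x eigenproj_sym rho_gt0 eigenproj_sqr.
rewrite uMu Maa; have -> : (u *m M) 0 a = 0.
  by rewrite uM 2!mxE ua wa mulr0 addr0.
have -> : \sum_i M a i * (u *m M) 0 i * x 0 i
    = (1 - c) * d * g1 * dot u u - c * g2 * dot w w.
  rewrite /dot !mulr_sumr -sumrB; apply: eq_bigr => i _.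
  have -> : (u *m M) 0 i = d * u 0 i + w 0 i by rewrite uM !mxE.
  rewrite xE.
  have [->|ia] := eqVneq i a; first by rewrite ua wa; ring.
  rewrite !mxE eq_sym (negPf ia) mulr0n addr0.
  by have [/ws ->|/supp ->] := boolP (adj a i); rewrite /=; ring.
(* The squared entries of [M] are (3-c)^2, (1-c)^2 and c^2. Subtracting c^2 throughout changes
   nothing, as [x] sums to zero, and leaves 9-6c on the diagonal and 1-2c on edges. *)
have -> : \sum_i \sum_j x 0 i * x 0 j * M i j ^+ 2
    = (9 - 6 * c) * dot x x + (1 - 2 * c) * dot (x *m A) x.
  have sumx : \sum_i x 0 i = 0.
    under eq_bigr do rewrite xE.
    by rewrite big_split -!mulr_sumr /= sum0 sumw !mulr0 addr0.
  rewrite exchange_big /dot !mulr_sumr -big_split; apply: eq_bigr => j _ /=.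
  transitivity (\sum_i ((x 0 i * x 0 j * (9 - 6 * c)) *+ (i == j)
      + ((1 - 2 * c) * x 0 j * (x 0 i * A i j) + c ^+ 2 * x 0 j * x 0 i))).
    apply: eq_bigr => i _; rewrite !mxE.
    have [->|_] := eqVneq i j; first by rewrite irrA /=; ring.
    by case: (adj i j) => /=; ring.
  rewrite !big_split /= -!mulr_sumr sumx mulr0 addr0 [(x *m A) 0 j]mxE.
  congr (_ + _); last by ring.
  rewrite (bigD1 j) //= eqxx big1 => [|i /negPf ->]; last by rewrite mulr0n.
  by rewrite mulr1n; ring.
have -> : dot x x = (g1 ^+ 2 + e * g2 ^+ 2) * dot u u.
  rewrite /x !(dotDl, dotDr, dotZl, dotZr) [dot w u]dotC uw ww eE; ring.
have -> : dot (x *m A) x = ((d - 3) * g1 ^+ 2 + 2 * e * g1 * g2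
                         + (rho - 3 - d) * e * g2 ^+ 2) * dot u u.
  rewrite /x mulmxDl -!scalemxAl wA uAE.
  rewrite !(dotDl, dotDr, dotZl, dotZr) [dot w u]dotC uw ww eE; ring.
rewrite ww -eE => H; rewrite -(pmulr_lge0 _ s0).
by move: H; congr (_ <= _); field.
Qed.
End AdjacencyMatrix.

(** A nonzero [d 0 i] is a local eigenvalue plus 3. The value 0 collects the padding outside the
    neighborhood, the constants on it, and the local eigenvalue -3. *)
Lemma local_eigenvalues (R : rcfType) n (adj : rel 'I_n) k l m
    (rho c kap : R) a :
  strongly_regular adj n k l m -> 0 < rho -> l%:R - m%:R = rho - 6 ->
  k%:R - m%:R = 3 * (rho - 3) -> c * n%:R = k%:R + 3 ->
  m%:R = c * (k%:R - (rho - 3)) -> c < 3 -> kap * k%:R = l%:R + 3 ->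
  (kap - c) * (3 - c) = (1 - c) ^+ 2 ->
  exists (Q : 'M[R]_n) (d : 'rV[R]_n),
  [/\ Q *m Q^T = 1%:M /\ localmx adj kap a = Q^T *m diag_mx d *m Q,
      \sum_i d 0 i = k%:R * (3 - kap),
      \sum_i d 0 i ^+ 2 = k%:R * (3 - kap) ^+ 2
        + k%:R * l%:R * (1 - kap) ^+ 2 + k%:R * (k%:R - 1 - l%:R) * kap ^+ 2,
      (\sum_(i | d 0 i != 0) 1) * rho <= n%:R * (3 - c) - rho
    & forall i, d 0 i != 0 ->
      [/\ 0 < d 0 i, d 0 i <= rho
        & forall g1 g2 e : R, e = (rho - d 0 i) * d 0 i ->
          0 <= (3 - c) * d 0 i / 2
            - 2 * ((1 - c) * d 0 i * g1 - c * e * g2)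
            + (9 - 6 * c) * (g1 ^+ 2 + e * g2 ^+ 2)
            + (1 - 2 * c) * ((d 0 i - 3) * g1 ^+ 2 + 2 * e * g1 * g2
                             + (rho - 3 - d 0 i) * e * g2 ^+ 2)]].
Proof.
move=> srg rho0 lm km cE mE c3 kapE kapc.
have [Q [d [QQ CE]]] := symmetric_diagonalization (localmx_sym srg kap a).
exists Q, d; split => //.
- by rewrite -(diagonalized_trace QQ CE) (localmx_trace srg kap a).
- rewrite -(localmx_sqr_trace srg kap a) (diagonalized_sqr QQ CE).
  rewrite (diagonalized_trace QQ erefl).
  by apply: eq_bigr => i _; rewrite mxE.
- have -> : \sum_(i | d 0 i != 0) 1 = (\rank (localmx adj kap a))%:R :> R.
    by rewrite (diagonalized_rank QQ CE) -sum1_card natr_sum.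
  exact: (localmx_rank srg).
- move=> i di.
  apply: (localmx_spectrum srg rho0 lm km cE mE kapE _ _ di).
    exact: (diagonalized_eigenvector QQ CE).
  exact: (diagonalized_row_neq0 QQ).
Qed.

(** * Constraints on a spectrum from its power sums *)

Lemma sum_square_root (R : rcfType) (I : finType) (P : pred I) (x : I -> R) D :
  (forall i, P i -> x i ^+ 2 = D) ->
  exists N : nat, (\sum_(i | P i) x i) ^+ 2 = D * N%:R ^+ 2.
Proof.
move=> xD; have [Dneg|D0] := ltP D 0.
  exists 0; rewrite expr0n mulr0 big1 ?expr0n // => i Pi.
  by have := sqr_ge0 (x i); rewrite xD // leNgt Dneg.
(* Each term is a square root of [D], so the sum is an integer multiple of one of them. *)
suff [N ->] : exists N : int, \sum_(i | P i) x i = Num.sqrt D * N%:~R.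
  exists `|N|%N; rewrite exprMn sqr_sqrtr // natr_absz intr_norm.
  by rewrite real_normK // num_real.
elim/big_rec: _ => [|i y Pi [N ->]]; first by exists 0; rewrite mulr0.
have : x i ^+ 2 == Num.sqrt D ^+ 2 by rewrite sqr_sqrtr // xD.
rewrite eqf_sqr => /orP[] /eqP ->.
  by exists (1 + N); rewrite rmorphD mulrDr mulr1.
by exists (-1 + N); rewrite rmorphD /= mulrDr mulrN1.
Qed.

(** If [z] is the number of nonzero eigenvalues, the nonnegative values of the quadratic sum to
    [q * (z - s) <= 0]. Hence [z = s], every nonzero eigenvalue is a root, and [sum_square_root]
    applies to [2 * d 0 i - p]. *)
Lemma extremal_spectrum (R : rcfType) n (d : 'rV[R]_n) p q T1 T2 s :
  \sum_i d 0 i = T1 -> \sum_i d 0 i ^+ 2 = T2 ->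
  \sum_(i | d 0 i != 0) 1 <= s ->
  (forall i, d 0 i != 0 -> 0 <= d 0 i ^+ 2 - p * d 0 i + q) ->
  0 < q -> T2 - p * T1 + q * s = 0 ->
  exists N : nat, (2 * T1 - p * s) ^+ 2 = (p ^+ 2 - 4 * q) * N%:R ^+ 2.
Proof.
move=> dT1 dT2 ds dq q0 Ts.
have nz (F : 'I_n -> R) : (forall i, d 0 i = 0 -> F i = 0) ->
    \sum_i F i = \sum_(i | d 0 i != 0) F i.
  move=> F0; rewrite [RHS]big_mkcond; apply: eq_bigr => i _.
  by case: eqP => // /F0.
have S1 : \sum_(i | d 0 i != 0) d 0 i = T1 by rewrite -nz.
have S2 : \sum_(i | d 0 i != 0) d 0 i ^+ 2 = T2.
  by rewrite -nz // => i ->; rewrite expr0n.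
have cst x : \sum_(i | d 0 i != 0) x = x * \sum_(i | d 0 i != 0) 1.
  by rewrite mulr_sumr; apply: eq_bigr => i _; rewrite mulr1.
have sumq : \sum_(i | d 0 i != 0) (d 0 i ^+ 2 - p * d 0 i + q)
    = T2 - p * T1 + q * \sum_(i | d 0 i != 0) 1.
  by rewrite big_split sumrB /= -mulr_sumr S1 S2 cst.
have [sE sum0] : \sum_(i | d 0 i != 0) 1 = s /\
    \sum_(i | d 0 i != 0) (d 0 i ^+ 2 - p * d 0 i + q) = 0.
  have := sumr_ge0 (index_enum _) dq; rewrite sumq.
  move: ds; set z := \sum_(i | _) 1 => ds ge0.
  suff sE : z = s by rewrite sE.
  apply/le_anti; rewrite ds /= -(ler_pM2l q0).
  rewrite -subr_ge0; suff <- : T2 - p * T1 + q * z = q * z - q * s by [].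
  by rewrite -[LHS]subr0 -Ts; ring.
have xD i : d 0 i != 0 -> (2 * d 0 i - p) ^+ 2 = p ^+ 2 - 4 * q.
  move=> di; have qd := psumr_eq0P dq sum0 di.
  rewrite (_ : _ ^+ 2 = 4 * (d 0 i ^+ 2 - p * d 0 i + q) + (p ^+ 2 - 4 * q)).
    by rewrite qd mulr0 add0r.
  by ring.
have [N NE] := sum_square_root xD; exists N; rewrite -NE; congr (_ ^+ 2).
by rewrite sumrB -mulr_sumr S1 cst sE.
Qed.

(** * The four parameter sets *)

Lemma no_srg_351_140_73_44 n (adj : rel 'I_n) :
  n = 351 -> ~ strongly_regular adj n 140 73 44.
Proof.
move=> nE srg; have n0 : (0 < n)%N by rewrite nE.
have nR : n%:R = 351 :> realalg by rewrite nE.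
have [||||||||Q [d [_ dT1 dT2 rk gap]]] := @local_eigenvalues realalg n adj
  140 73 44 35 (11 / 27) (19 / 35) (Ordinal n0) srg.
1-8: by rewrite ?nR; lra.
have s25 : \sum_(i | d 0 i != 0) 1 <= 25 :> realalg by rewrite nR in rk; lra.
have T1E : \sum_i d 0 i = 344 by rewrite dT1; lra.
have T2E : \sum_i d 0 i ^+ 2 = 5704 by rewrite dT2; lra.
move: gap s25 T1E T2E; clear => gap s25 T1 T2.
have dq (i : 'I_n) : d 0 i != 0 -> 0 <= d 0 i ^+ 2 - 41 * d 0 i + 336.
  (* The witnesses solve the 2 by 2 linear system for the minimizing [g1], [g2]. Its determinant
     [36 + 6 * (1 - 2 * c) * rho] does not involve the eigenvalue, so they are polynomials in it;
     the same holds for the other parameter sets. *)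
  move=> /gap [d0 _ /(_ (d 0 i * (- 5 / 2022 * d 0 i + 271 / 2022))
    (- 5 / 2022 * d 0 i - 11 / 337) _ erefl) H].
  have K0 : 0 < 5 / 2022 :> realalg by rewrite divr_gt0.
  rewrite -(pmulr_rge0 _ d0) -(pmulr_rge0 _ K0).
  by move: H; congr (_ <= _); field.
have [||N NE] := extremal_spectrum T1 T2 s25 dq.
1-2: by clear; lra.
move: NE; clear => NE.
(* The discriminant 41^2 - 4 * 336 is 337 and [2 * T1 - p * s] is -337; 337 is not a square. *)
have : (N * N = 337)%N; last by case: (leqP N 18); nia.
apply/eqP; rewrite -(eqr_nat realalg) natrM -expr2; apply/eqP; lra.
Qed.

Lemma no_srg_703_182_81_35 n (adj : rel 'I_n) :
  n = 703 -> ~ strongly_regular adj n 182 81 35.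
Proof.
move=> nE srg; have n0 : (0 < n)%N by rewrite nE.
have nR : n%:R = 703 :> realalg by rewrite nE.
have [||||||||Q [d [_ dT1 dT2 rk gap]]] := @local_eigenvalues realalg n adj
  182 81 35 52 (5 / 19) (6 / 13) (Ordinal n0) srg.
1-8: by rewrite ?nR; lra.
have s36 : \sum_(i | d 0 i != 0) 1 <= 36 :> realalg by rewrite nR in rk; lra.
have T1E : \sum_i d 0 i = 462 by rewrite dT1; lra.
have T2E : \sum_i d 0 i ^+ 2 = 9324 by rewrite dT2; lra.
move: gap s36 T1E T2E; clear => gap s36 T1 T2.
have dq (i : 'I_n) : d 0 i != 0 -> 0 <= d 0 i ^+ 2 - 58 * d 0 i + 1456 / 3.
  move=> /gap [d0 _ /(_ (d 0 i * (- 1 / 388 * d 0 i + 46 / 291))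
    (- 1 / 388 * d 0 i - 5 / 582) _ erefl) H].
  have K0 : 0 < 1 / 388 :> realalg by rewrite divr_gt0.
  rewrite -(pmulr_rge0 _ d0) -(pmulr_rge0 _ K0).
  by move: H; congr (_ <= _); field.
have [||N NE] := extremal_spectrum T1 T2 s36 dq.
1-2: by clear; lra.
move: NE; clear => NE.
(* The discriminant is 4268/3 and [2 * T1 - p * s] is -1164, so [N ^ 2] would be 10476/11. *)
have : (952 < N * N < 953)%N; last by lia.
by rewrite -!(ltr_nat realalg) natrM -expr2; apply/andP; split; lra.
Qed.

Lemma sum_indicator (R : pzSemiRingType) n (P : pred 'I_n) :
  \sum_i (P i)%:R = #|P|%:R :> R.
Proof.
rewrite -sum1_card natr_sum [RHS]big_mkcond; apply: eq_bigr => i _.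
by rewrite -topredE /=; case: (P i).
Qed.

(** A Chebyshev bound: sum the squares of [d 0 i - tau] over the nonzero eigenvalues, each large one
    contributing at least [(h - tau) ^+ 2]. *)
Lemma count_large_le (R : realFieldType) n (d : 'rV[R]_n) T1 T2 s tau h :
  \sum_i d 0 i = T1 -> \sum_i d 0 i ^+ 2 = T2 ->
  \sum_(i | d 0 i != 0) 1 <= s -> 0 <= tau -> tau < h ->
  (h - tau) ^+ 2 * #|[pred i | h <= d 0 i]|%:R
    <= T2 - 2 * tau * T1 + tau ^+ 2 * s.
Proof.
move=> dT1 dT2 ds t0 th.
apply: (@le_trans _ _ (\sum_i (d 0 i ^+ 2 - 2 * tau * d 0 i
                               + tau ^+ 2 * (d 0 i != 0)%:R))).
  rewrite -sum_indicator mulr_sumr ler_sum // => i _ /=.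
  have [hd|_] := leP h (d 0 i).
    have dn0 : d 0 i != 0 by rewrite gt_eqF // (lt_le_trans _ hd) // (le_lt_trans t0).
    rewrite dn0 !mulr1; have -> : d 0 i ^+ 2 - 2 * tau * d 0 i + tau ^+ 2
        = (d 0 i - tau) ^+ 2 by ring.
    by rewrite lerXn2r ?nnegrE ?lerD2r // subr_ge0 ltW // (lt_le_trans th).
  rewrite mulr0; case: eqP => [->|_] /=; first by rewrite expr0n !mulr0 subr0 addr0.
  rewrite mulr1; have -> : d 0 i ^+ 2 - 2 * tau * d 0 i + tau ^+ 2
      = (d 0 i - tau) ^+ 2 by ring.
  exact: sqr_ge0.
rewrite big_split sumrB -!mulr_sumr dT1 dT2 /= lerD2l ler_wpM2l ?sqr_ge0 //.
apply: le_trans ds; rewrite [leRHS]big_mkcond ler_sum // => i _.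
by case: (d 0 i != 0).
Qed.

(** Sum [d 0 i * (d 0 i - l)]: it is nonpositive below the gap and at most [rho * (rho - l)] above
    it. *)
Lemma count_large_ge (R : realFieldType) n (d : 'rV[R]_n) T1 T2 l h rho :
  \sum_i d 0 i = T1 -> \sum_i d 0 i ^+ 2 = T2 -> 0 <= l -> l < h ->
  (forall i, 0 <= d 0 i) -> (forall i, d 0 i <= rho) ->
  (forall i, d 0 i < h -> d 0 i <= l) ->
  T2 <= l * T1 + rho * (rho - l) * #|[pred i | h <= d 0 i]|%:R.
Proof.
move=> <- <- l0 lh d0 drho gap.
rewrite -sum_indicator !mulr_sumr -big_split ler_sum // => i _ /=.
rewrite -lerBlDl (_ : _ - _ = d 0 i * (d 0 i - l)); last by ring.
have [hd|/gap dl] := leP h (d 0 i).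
  have ld : l <= d 0 i by rewrite ltW // (lt_le_trans lh).
  by rewrite mulr1 ler_pM ?lerD2r // subr_ge0.
by rewrite mulr0 mulr_ge0_le0 // subr_le0.
Qed.

Lemma no_srg_550_162_75_36 n (adj : rel 'I_n) :
  n = 550 -> ~ strongly_regular adj n 162 75 36.
Proof.
move=> nE srg; have n0 : (0 < n)%N by rewrite nE.
have nR : n%:R = 550 :> realalg by rewrite nE.
have [||||||||Q [d [_ dT1 dT2 rk gap]]] := @local_eigenvalues realalg n adj
  162 75 36 45 (3 / 10) (13 / 27) (Ordinal n0) srg.
1-8: by rewrite ?nR; lra.
have s32 : \sum_(i | d 0 i != 0) 1 <= 32 :> realalg by rewrite nR in rk; lra.
have T1E : \sum_i d 0 i = 408 by rewrite dT1; lra.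
have T2E : \sum_i d 0 i ^+ 2 = 7524 by rewrite dT2; lra.
move: gap s32 T1E T2E; clear => gap s32 T1 T2.
have dq i : [/\ 0 <= d 0 i, d 0 i <= 45 & d 0 i < 81 / 2 -> d 0 i <= 21 / 2].
  have [->|/gap] := eqVneq (d 0 i) 0; first by split=> //; lra.
  move=> [d0 d1 /(_ (d 0 i * (- 1 / 360 * d 0 i + 37 / 240))
    (- 1 / 360 * d 0 i - 1 / 80) _ erefl) H]; split; rewrite ?(ltW d0) // => d2.
  have : 0 <= (d 0 i - 21 / 2) * (d 0 i - 81 / 2).
    have K0 : 0 < 1 / 360 :> realalg by rewrite divr_gt0.
    rewrite -(pmulr_rge0 _ d0) -(pmulr_rge0 _ K0).
    by move: H; congr (_ <= _); field.
  by rewrite nmulr_lge0 ?subr_le0 // subr_lt0.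
(* For the number [N] of eigenvalues that are at least 81/2, the two counts give 1552.5 N >= 3240
   and, with [tau = 10], 930.25 N <= 2564. *)
have [] : 0 <= 21 / 2 :> realalg /\ 21 / 2 < 81 / 2 :> realalg by clear; lra.
move=> l0 lh; have := count_large_ge T1 T2 l0 lh (rho := 45).
have [] : 0 <= 10 :> realalg /\ 10 < 81 / 2 :> realalg by clear; lra.
move=> t0 th; have := count_large_le T1 T2 s32 t0 th.
set N := #|_|; move: N => N ub lb.
have {dq}lb : 7524 <= 21 / 2 * 408 + 45 * (45 - 21 / 2) * N%:R :> realalg.
  by apply: lb => i; have [] := dq i.
move: ub lb; clear => ub lb; have [N2|N3] := leqP N 2.
  have : N%:R <= 2 :> realalg by rewrite ler_nat.
  by lra.
have : 3 <= N%:R :> realalg by rewrite ler_nat.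
by lra.
Qed.

Lemma local_spectrum_1344_221_88_26 n (adj : rel 'I_n) (a : 'I_n) :
  n = 1344 -> strongly_regular adj n 221 88 26 ->
  exists (Q : 'M[realalg]_n) (d : 'rV_n) (P : pred 'I_n),
  [/\ Q *m Q^T = 1%:M, localmx adj (7 / 17) a = Q^T *m diag_mx d *m Q,
      (#|P| <= 2)%N & forall i, ~~ P i -> d 0 i ^+ 2 - 10 * d 0 i <= 0].
Proof.
move=> nE srg; have nR : n%:R = 1344 :> realalg by rewrite nE.
have [||||||||Q [d [[QQ CE] dT1 dT2 rk gap]]] := @local_eigenvalues realalg n adj
  221 88 26 68 (1 / 6) (7 / 17) a srg.
1-8: by rewrite ?nR; lra.
have s55 : \sum_(i | d 0 i != 0) 1 <= 55 :> realalg by rewrite nR in rk; lra.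
have T1E : \sum_i d 0 i = 572 by rewrite dT1; lra.
have T2E : \sum_i d 0 i ^+ 2 = 13156 by rewrite dT2; lra.
exists Q, d, [pred i | 64 <= d 0 i]; split => //; move: gap s55 T1E T2E.
  clear => _ s55 T1 T2; have := count_large_le T1 T2 s55 (tau := 6) (h := 64).
  set N := #|_|; move: N => N; clear => ub; rewrite leqNgt; apply/negP => N3.
  have : (64 - 6) ^+ 2 * N%:R <= 13156 - 2 * 6 * 572 + 6 ^+ 2 * 55 :> realalg.
    by apply: ub; lra.
  have : 3 <= N%:R :> realalg by rewrite ler_nat.
  by lra.
clear => gap _ _ _ i; rewrite -ltNge => d2.
have -> : d 0 i ^+ 2 - 10 * d 0 i = d 0 i * (d 0 i - 10) by ring.
have [->|/gap] := eqVneq (d 0 i) 0; first by rewrite mul0r.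
move=> [d0 _ /(_ (d 0 i * (- 1 / 462 * d 0 i + 151 / 924))
  (- 1 / 462 * d 0 i - 1 / 308) _ erefl)]; move: (d 0 i) d0 d2.
clear => x x0 x64 H; rewrite pmulr_rle0 // subr_le0 leNgt; apply/negP => x10.
(* The roots 37 ± sqrt(731.5) lie just outside the interval from 10 to 64, so the quadratic is
   negative there. *)
have : 0 <= x ^+ 2 - 74 * x + 1275 / 2.
  have K0 : 0 < 1 / 462 :> realalg by rewrite divr_gt0.
  rewrite -(pmulr_rge0 _ x0) -(pmulr_rge0 _ K0).
  by move: H; congr (_ <= _); field.
have : 0 < (x - 10) * (64 - x) by rewrite mulr_gt0 // subr_gt0.
by lra.
Qed.

(** * Independent sets and cliques for (1344,221,88,26) *)

Lemma rank_lt_kernel (F : fieldType) r n s (X : 'M[F]_(r, n)) (Y : 'M_(n, s)) :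
  (\rank Y < r)%N -> exists2 y : 'rV_r, y != 0 & y *m X *m Y = 0.
Proof.
move=> Yr; have Kn0 : kermx (X *m Y) != 0.
  rewrite kermx_eq0 /row_free neq_ltn.
  by rewrite (leq_ltn_trans (mxrankM_maxr _ _) Yr).
exists (nz_row (kermx (X *m Y))); first by rewrite nz_row_eq0.
rewrite -mulmxA; apply/sub_kermxP; exact: nz_row_sub.
Qed.

(** At most three linear conditions are imposed on four coefficients. *)
Lemma orthogonal_combination (R : rcfType) n (Q : 'M[R]_n) (P : pred 'I_n)
    (X : 'M[R]_(4, n)) (v : 'rV_n) : (#|P| <= 2)%N ->
  exists y : 'rV_4, [/\ y != 0, dot (y *m X) v = 0
    & forall i, P i -> dot (y *m X) (row i Q) = 0].
Proof.
move=> P2; pose Z : 'M[R]_n := Q^T *m diag_mx (\row_i (P i)%:R).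
have rZ : (\rank Z <= 2)%N.
  rewrite (leq_trans (mxrankM_maxr _ _)) // rank_diag_mx (leq_trans _ P2) //.
  apply/subset_leq_card/subsetP => i; rewrite !inE mxE.
  by rewrite -topredE /=; case: (P i); rewrite ?eqxx.
have [|y yn0 yE] := @rank_lt_kernel _ 4 n _ X (row_mx v^T Z).
  rewrite -mxrank_tr tr_row_mx -addsmxE.
  rewrite (leq_ltn_trans (mxrank_adds_leqif _ _)) // !mxrank_tr.
  by have := rank_leq_row v; lia.
move: yE; rewrite mul_mx_row -[0]row_mx0 => /eq_row_mx [yv yZ].
exists y; split => // [|i Pi]; first by rewrite -dotE yv mxE.
move/rowP/(_ i): yZ; rewrite mulmxA mul_mx_diag !mxE Pi mulr1 => <-.
by apply: eq_bigr => j _; rewrite !mxE.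
Qed.

(** For [0 <= g <= 25] one has [g * (y * y') >= - 25 / 4 * (y - y') ^+ 2]. As the [y i] sum to zero,
    these bounds cost 50 times the sum of squares, and 38 = 88 - 50. *)
Lemma gram4_lower_bound (R : realFieldType) (y : 'I_4 -> R) (g : 'I_4 -> 'I_4 -> R) :
  (forall i, g i i = 88) -> (forall i j, i != j -> 0 <= g i j <= 25) ->
  \sum_i y i = 0 ->
  38 * \sum_i y i ^+ 2 <= \sum_i \sum_j g i j * (y i * y j).
Proof.
move=> gii gij y0.
have sumsq : \sum_i \sum_j (25 / 2 * (y i * y j)
    - 25 / 4 * (y i ^+ 2 + y j ^+ 2) + (88 * y i ^+ 2) *+ (i == j))
    = 38 * \sum_i y i ^+ 2.
  transitivity (\sum_i (38 * y i ^+ 2 - 25 / 4 * \sum_j y j ^+ 2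
                        + 25 * y i ^+ 2)).
    apply: eq_bigr => i _; rewrite big_split sumrB -!mulr_sumr y0 big_split /=.
    have -> : \sum_j (88 * y i ^+ 2) *+ (i == j) = 88 * y i ^+ 2.
      rewrite (bigD1 i) //= eqxx big1 => [|j]; first by rewrite addr0 mulr1n.
      by rewrite eq_sym => /negPf ->; rewrite mulr0n.
    by rewrite sumr_const card_ord -mulr_natr; lra.
  rewrite big_split sumrB -!mulr_sumr sumr_const card_ord /=.
  by rewrite -mulr_natr; lra.
rewrite -sumsq; apply: ler_sum => i _; apply: ler_sum => j _.
have [->|ij] := eqVneq i j; first by rewrite gii mulr1n; lra.
rewrite mulr0n addr0; have /andP[g0 g1] := gij _ _ ij.
have h1 : 0 <= g i j * (y i + y j) ^+ 2 by rewrite mulr_ge0 ?sqr_ge0.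
have h2 : 0 <= (25 - g i j) * (y i - y j) ^+ 2.
  by rewrite mulr_ge0 ?sqr_ge0 ?subr_ge0.
lra.
Qed.

(* A nonzero combination [x] of the four indicator vectors is orthogonal to the
   all-one vector and to the at most two large eigenvectors, so the form
   [C ^+ 2 - 10 *: C], which is [(B + 3) * (B - 7)], is nonpositive at [x]; but
   it is positive definite on vectors supported by the quadruple. *)
Lemma no_independent_quadruple n (adj : rel 'I_n) a (u : 'I_4 -> 'I_n) :
  n = 1344 -> strongly_regular adj n 221 88 26 -> injective u ->
  (forall i, adj a (u i)) -> (forall i j, i != j -> ~~ adj (u i) (u j)) ->
  False.
Proof.
move=> nE srg u_inj au uu; have [[symA irrA] _ _ adjA nadjA] := srg.
have [Q [d [P [QQ CE P2 neg]]]] := local_spectrum_1344_221_88_26 a nE srg.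
set C := localmx _ _ _ in CE.
pose X : 'M[realalg]_(4, n) := \matrix_(i, j) (u i == j)%:R.
pose v : 'rV[realalg]_n := \row_j (adj a j)%:R.
have [y [yn0 yv yQ]] := orthogonal_combination Q X v P2.
pose Y i := y 0 i; pose x := y *m X.
have xE j : x 0 j = \sum_i Y i * (u i == j)%:R.
  by rewrite mxE; apply: eq_bigr => i _; rewrite mxE.
have sum_x (F : 'I_n -> realalg) : \sum_j x 0 j * F j = \sum_i Y i * F (u i).
  under eq_bigr do rewrite xE mulr_suml.
  rewrite exchange_big; apply: eq_bigr => i _ /=.
  rewrite (bigD1 (u i)) //= eqxx mulr1 big1 ?addr0 // => j.
  by rewrite eq_sym => /negPf ->; rewrite mulr0 mul0r.
have xu i : x 0 (u i) = Y i.
  rewrite xE (bigD1 i) //= eqxx mulr1 big1 ?addr0 // => j.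
  by rewrite -(inj_eq u_inj) => /negPf ->; rewrite mulr0.
have sumY : \sum_i Y i = 0.
  rewrite -[RHS]yv /dot sum_x; apply: eq_bigr => i _.
  by rewrite mxE au mulr1.
pose t j := \sum_i Y i * (adj (u i) j)%:R.
have tu i : t (u i) = 0.
  rewrite /t big1 // => j _; have [->|ji] := eqVneq j i.
    by rewrite irrA mulr0.
  by rewrite (negPf (uu _ _ ji)) mulr0.
have xC j : (x *m C) 0 j = (adj a j)%:R * (t j + 3 * x 0 j).
  rewrite mxE sum_x mulrDr /t mulr_sumr.
  transitivity (\sum_i ((adj a j)%:R * (Y i * (adj (u i) j)%:R)
     + (adj a j)%:R * (3 * (Y i * (u i == j)%:R)) - 7 / 17 * (adj a j)%:R * Y i)).
    apply: eq_bigr => i _; rewrite !mxE au.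
    by case: (u i == j); case: (adj a j); rewrite /=; ring.
  by rewrite sumrB big_split /= -!mulr_sumr sumY -xE mulr0 subr0.
have xx : dot x x = \sum_i Y i ^+ 2.
  by rewrite /dot sum_x; apply: eq_bigr => i _; rewrite xu.
have xCx : dot (x *m C) x = 3 * \sum_i Y i ^+ 2.
  rewrite dotC /dot sum_x mulr_sumr; apply: eq_bigr => i _.
  by rewrite xC au mul1r tu xu; ring.
pose g i i' : realalg := \sum_j (adj a j)%:R * ((adj (u i) j)%:R * (adj (u i') j)%:R).
(* There are no cross terms: [t] vanishes on the quadruple by independence, and [x] vanishes off
   it. *)
have xCC : dot (x *m C) (x *m C)
    = \sum_i \sum_i' g i i' * (Y i * Y i') + 9 * \sum_i Y i ^+ 2.
  rewrite -xx /dot mulr_sumr.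
  have -> : \sum_i \sum_i' g i i' * (Y i * Y i') = \sum_j (adj a j)%:R * t j ^+ 2.
    transitivity (\sum_i \sum_i' \sum_j (adj a j)%:R
       * ((Y i * (adj (u i) j)%:R) * (Y i' * (adj (u i') j)%:R))).
      apply: eq_bigr => i _; apply: eq_bigr => i' _; rewrite mulr_suml.
      by apply: eq_bigr => j _; ring.
    under eq_bigr do rewrite exchange_big.
    rewrite exchange_big; apply: eq_bigr => j _ /=.
    rewrite expr2 {1}/t mulr_suml mulr_sumr; apply: eq_bigr => i _.
    by rewrite /t !mulr_sumr; apply: eq_bigr => i' _; ring.
  rewrite -big_split; apply: eq_bigr => j _ /=; rewrite xC.
  have [j0|[i ->]] : x 0 j = 0 \/ exists i, j = u i.
    have [/existsP[i /eqP <-]|/existsPn uj] := boolP [exists i, u i == j].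
      by right; exists i.
    by left; rewrite xE big1 // => i _; rewrite (negPf (uj i)) mulr0.
  - by rewrite j0; case: (adj a j) => /=; ring.
  - by rewrite tu au !mul1r; ring.
have gE i i' : g i i' = #|neighbors adj a :&: common_neighbors adj (u i) (u i')|%:R.
  rewrite -sum1_card natr_sum big_mkcond; apply: eq_bigr => j _ /=.
  by rewrite !inE; case: (adj a j); case: (adj (u i) j); case: (adj (u i') j);
    rewrite /= ?(mulr0, mul0r, mulr1).
have gii i : g i i = 88.
  rewrite gE (_ : _ :&: _ = common_neighbors adj a (u i)) ?adjA //.
  by rewrite /common_neighbors setIid.
have gij i j : i != j -> 0 <= g i j <= 25.
  move=> ij; rewrite gE ler0n ler_nat -ltnS.
  rewrite -(nadjA (u i) (u j)) ?uu ?(inj_eq u_inj) //.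
  apply: proper_card; rewrite properE subsetIr /=; apply/subsetPn; exists a.
    by rewrite !inE !(symA _ a) !au.
  by rewrite !inE irrA.
have bound := gram4_lower_bound gii gij sumY.
have form : dot (x *m C) (x *m C) - 10 * dot (x *m C) x <= 0.
  have -> : dot (x *m C) (x *m C) = dot (x *m (C *m C)) x.
    by rewrite [LHS]dot_mulmx (localmx_sym srg) mulmxA dotC.
  rewrite (diagonalized_form (diagonalized_sqr QQ CE)) (diagonalized_form CE).
  rewrite mulr_sumr -sumrB sumr_le0 // => i _.
  rewrite [(\row__ _) 0 i]mxE; set z := dot x (row i Q).
  have -> : d 0 i ^+ 2 * z ^+ 2 - 10 * (d 0 i * z ^+ 2)
      = (d 0 i ^+ 2 - 10 * d 0 i) * z ^+ 2 by ring.
  rewrite {}/z; have [Pi|/neg ?] := boolP (P i); first by rewrite yQ // expr0n mulr0.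
  by rewrite mulr_le0_ge0 ?sqr_ge0.
(* The form is at least 38 + 9 - 30 = 17 times this sum. *)
have Y0 : \sum_i Y i ^+ 2 = 0.
  apply: le_anti; rewrite sumr_ge0 => [|i _]; last exact: sqr_ge0.
  by move: form; rewrite xCC xCx andbT; lra.
case/eqP: yn0; apply/rowP => i; rewrite mxE; apply/eqP.
rewrite -sqrf_eq0; apply/eqP; apply: (psumr_eq0P _ Y0) => // j _.
exact: sqr_ge0.
Qed.

(* The Delsarte bound $1 + k/3 < 75$: the form below is $68$ times the squared
   norm of the projection of the characteristic vector of [K] onto the
   eigenspace for $-3$. *)
Lemma clique_bound_1344_221_88_26 n (adj : rel 'I_n) (K : {set 'I_n}) :
  n = 1344 -> strongly_regular adj n 221 88 26 -> is_clique adj K ->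
  (#|K| <= 74)%N.
Proof.
move=> nE srg /cliqueP cK; have [[symA irrA] _ _ _ _] := srg.
pose A := adjmx realalg adj; pose s : realalg := #|K|%:R.
pose x : 'rV[realalg]_n := \row_i (i \in K)%:R.
pose w : 'rV[realalg]_n := const_mx 1.
have xw : dot x w = s.
  rewrite /s -sum1_card natr_sum big_mkcond; apply: eq_bigr => i _.
  by rewrite !mxE mulr1; case: (i \in K).
have xx : dot x x = s.
  rewrite -xw; apply: eq_bigr => i _; rewrite !mxE.
  by case: (i \in K); rewrite ?mulr1 ?mulr0 ?mul0r.
have ww : dot w w = 1344.
  rewrite /dot (eq_bigr (fun=> 1)) => [|i _]; last by rewrite !mxE mulr1.
  by rewrite sumr_const card_ord nE.
have sumx : \sum_i x 0 i = s.
  by rewrite -xw; apply: eq_bigr => i _; rewrite [w 0 i]mxE mulr1.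
have xAx : dot (x *m A) x = s * (s - 1).
  have -> : dot (x *m A) x = \sum_i x 0 i * (s - 1).
    rewrite dotC; apply: eq_bigr => i _.
    have [iK|iK] := boolP (i \in K); last by rewrite [x 0 i]mxE (negPf iK) !mul0r.
    congr (_ * _); rewrite mxE -sumx (bigD1 i) //= [in RHS](bigD1 i) //=.
    rewrite [x 0 i]mxE iK mxE irrA mulr0 add0r addrAC subrr add0r.
    apply: eq_bigr => j ji; rewrite !mxE.
    by have [jK|_] := boolP (j \in K); rewrite ?mul0r // cK ?mulr1.
  by rewrite -mulr_suml sumx.
have xAw : dot (x *m A) w = 221 * s.
  rewrite -sumx -(sum_mulmx_adjmx srg); apply: eq_bigr => i _.
  by rewrite [w 0 i]mxE mulr1.
have xAA : dot (x *m A) (x *m A) = 195 * s + 62 * (s * (s - 1)) + 26 * s ^+ 2.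
  rewrite dot_mulmx (adjmx_sym _ srg) -mulmxA dotC (adjmx_sqr _ srg).
  rewrite !mulmxDr mul_mx_scalar -scalemxAr mulmx_const sumx.
  rewrite !dotDl !dotZl xAx xx.
  have -> : const_mx (26 * s) = (26 * s) *: w by apply/rowP=> i; rewrite !mxE mulr1.
  by rewrite dotZl dotC xw; lra.
(* Subtracting 65 kills the eigenspace for 65, and 13/112 = (221 - 65)/1344 removes the constant
   component. *)
have := dot_ge0 (x *m A - 65 *: x - (13 / 112 * s) *: w).
rewrite -!scaleNr !(dotDl, dotDr, dotZl, dotZr) [dot x (x *m A)]dotC.
rewrite [dot w (x *m A)]dotC [dot w x]dotC xAA xAx xAw xx xw ww => form.
rewrite leqNgt; apply/negP => K75.
have s75 : 75 <= s by rewrite /s ler_nat.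
(* The threshold 112 * 66 / 99 equals 224/3 = 1 + 221/3. *)
have : 0 < s * (s - 112 * 66 / 99) by apply: mulr_gt0; lra.
have : 0 <= s * (66 - 99 / 112 * s) by lra.
lra.
Qed.

Lemma no_srg_1344_221_88_26 n (adj : rel 'I_n) :
  n = 1344 -> ~ strongly_regular adj n 221 88 26.
Proof.
move=> nE srg; have [[symA irrA] _ regA adjA nadjA] := srg.
have n0 : (0 < n)%N by rewrite nE.
pose a := Ordinal n0; pose S := neighbors adj a.
have inS x : x \in S = adj a x by rewrite inE.
apply: (@no_local_graph _ adj S symA irrA).
- exact: regA.
- by move=> x; rewrite inS => ax; rewrite -(adjA a x).
- move=> x y; rewrite !inS => ax ay; rewrite inE => /andP[xy nxy].
  rewrite -ltnS -(nadjA x y) //; apply: proper_card; rewrite properE.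
  rewrite -setIA subsetIr; apply/subsetPn; exists a.
    by rewrite !inE !(symA _ a) ax ay.
  by rewrite !inE irrA.
- move=> K /subsetP KS /cliqueP cK.
  have aK : a \notin K by apply/negP => /KS; rewrite inS irrA.
  have : (#|a |: K| <= 74)%N.
    apply: (clique_bound_1344_221_88_26 nE srg); apply/cliqueP => x y.
    rewrite !in_setU1 => /predU1P[->|xK] /predU1P[->|yK]; rewrite ?eqxx //.
    - by move=> _; rewrite -inS KS.
    - by move=> _; rewrite symA -inS KS.
    - exact: cK.
  by rewrite cardsU1 aK.
- move=> x y z w; rewrite !inS !inE => ax ay az aw.
  move=> /andP[xy nxy] /andP[xz nxz] /andP[xw nxw] /andP[yz nyz] /andP[yw nyw].
  move=> /andP[zw nzw].
  pose u (i : 'I_4) := nth x [:: x; y; z; w] i.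
  apply: (@no_independent_quadruple n adj a u) => //.
  + move=> i j /eqP; rewrite /u nth_uniq ?ltn_ord //= ?inE.
      by move/eqP/val_inj.
    by rewrite !negb_or xy xz xw yz yw zw.
  + by case=> [[|[|[|[|i]]]]].
  + by case=> [[|[|[|[|i]]]] ?] [[|[|[|[|j]]]] ?] //= _; rewrite symA.
Qed.

Local Close Scope ring_scope.

(** * Relabelling vertices by ordinals, and complements *)

Lemma strongly_regular_ordinal (T : finType) (adj : rel T) v k l m :
  strongly_regular adj v k l m ->
  exists adj' : rel 'I_v, strongly_regular adj' v k l m.
Proof.
case=> [[symA irrA] cardT regA adjA nadjA]; subst v.
pose f : 'I_#|T| -> T := enum_val; exists (fun i j => adj (f i) (f j)).
have cardf (P : {set T}) : #|[set i | f i \in P]| = #|P|.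
  by rewrite -[LHS]/#|f @^-1: P| on_card_preimset //; apply/onW_bij/enum_val_bij.
have comE i j : common_neighbors (fun i j => adj (f i) (f j)) i j
    = [set h | f h \in common_neighbors adj (f i) (f j)].
  by apply/setP => h; rewrite !inE.
split => //=; first by split=> [i j|i]; [exact: symA|exact: irrA].
- by rewrite card_ord.
- move=> i; rewrite -(regA (f i)) -cardf; apply: eq_card => j; by rewrite !inE.
- by move=> i j ij; rewrite comE cardf adjA.
- by move=> i j ij nij; rewrite comE cardf nadjA // (inj_eq enum_val_inj).
Qed.

(** Common neighbors in the complement avoid both vertices and both neighborhoods. The pair itself
    lies outside the two neighborhoods when non-adjacent, whence the extra 2, and inside them when
    adjacent. Additions precede the truncated subtractions. *)
Lemma strongly_regular_complement (T : finType) (adj : rel T) v k l m :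
  strongly_regular adj v k l m ->
  strongly_regular (fun x y => (x != y) && ~~ adj x y)
    v (v - k - 1)%N (v + m - 2 - k.*2)%N (v + l - k.*2)%N.
Proof.
case=> [[symA irrA] cardT regA adjA nadjA].
pose adj' : rel T := fun x y => (x != y) && ~~ adj x y.
have nbE x : neighbors adj' x = ~: (x |: neighbors adj x).
  by apply/setP => y; rewrite !inE negb_or eq_sym.
have comE x y : common_neighbors adj' x y
    = ~: ([set x; y] :|: (neighbors adj x :|: neighbors adj y)).
  apply/setP => z; rewrite !inE /adj' [z == x]eq_sym [z == y]eq_sym.
  by case: (x == z); case: (y == z); case: (adj x z); case: (adj y z).
have cardU x y : #|neighbors adj x :|: neighbors adj y|
    = (k + k - #|common_neighbors adj x y|)%N.
  by rewrite cardsU !regA.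
split => //.
- by split=> [x y|x]; rewrite ?eqxx // symA eq_sym.
- move=> x; rewrite -/adj' nbE cardsCs setCK cardsU1 inE irrA regA cardT.
  by rewrite subnDA subnAC.
- move=> x y; rewrite -/adj' => /andP[xy nxy].
  rewrite comE cardsCs setCK cardsU cardU cards2 xy cardT nadjA //.
  have -> : [set x; y] :&: (neighbors adj x :|: neighbors adj y) = set0.
    apply/setP => z; rewrite !inE; apply/negP.
    case/andP=> /orP[] /eqP -> ; rewrite ?irrA ?(negPf nxy) ?orbF //=.
      by rewrite symA (negPf nxy).
  rewrite cards0 subn0 /=.
  have : #|common_neighbors adj x y| <= k.
    by rewrite -(regA x) subset_leq_card // subsetIl.
  by rewrite nadjA //; lia.
- move=> x y xy; rewrite xy negbK => axy.
  rewrite -/adj' comE cardsCs setCK.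
  have -> : [set x; y] :|: (neighbors adj x :|: neighbors adj y)
      = neighbors adj x :|: neighbors adj y.
    apply/setUidPr/subsetP => z; rewrite !inE => /orP[] /eqP ->.
      by rewrite [adj y x]symA axy orbT.
    by rewrite axy.
  have : #|common_neighbors adj x y| <= k.
    by rewrite -(regA x) subset_leq_card // subsetIl.
  by rewrite cardU cardT adjA //; lia.
Qed.

Lemma no_srg_ordinal (T : finType) (adj : rel T) v k l m :
  (forall adj' : rel 'I_v, ~ strongly_regular adj' v k l m) ->
  ~ strongly_regular adj v k l m.
Proof. by move=> H /strongly_regular_ordinal[adj']; apply: H. Qed.

Theorem theorem1 (T : finType) (adj : rel T) :
  [/\ ~ strongly_regular adj 351 140 73 44,
      ~ strongly_regular adj 550 162 75 36,
      ~ strongly_regular adj 703 182 81 35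
    & ~ strongly_regular adj 1344 221 88 26] /\
  [/\ ~ strongly_regular adj 351 210 113 144,
      ~ strongly_regular adj 550 387 260 301,
      ~ strongly_regular adj 703 520 372 420
    & ~ strongly_regular adj 1344 1122 926 990].
Proof.
have no351 adj1 : ~ strongly_regular (T := T) adj1 351 140 73 44.
  by apply: no_srg_ordinal => adj'; apply: no_srg_351_140_73_44.
have no550 adj1 : ~ strongly_regular (T := T) adj1 550 162 75 36.
  by apply: no_srg_ordinal => adj'; apply: no_srg_550_162_75_36.
have no703 adj1 : ~ strongly_regular (T := T) adj1 703 182 81 35.
  by apply: no_srg_ordinal => adj'; apply: no_srg_703_182_81_35.
have no1344 adj1 : ~ strongly_regular (T := T) adj1 1344 221 88 26.
  by apply: no_srg_ordinal => adj'; apply: no_srg_1344_221_88_26.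
(* Complementing the last four parameter sets evaluates to the first four. *)
do 2!split=> //; move/strongly_regular_complement.
- exact: no351.
- exact: no550.
- exact: no703.
- exact: no1344.
Qed.
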